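(* Let $p\geq2$, $n_1,\dots,n_l\geq1$ be integers with $\sum_j p^{-n_j}=1$ and let $T_p$ be the map satisfying Condition 1 with slopes $\Lambda_j=p^{n_j}$. Let $U_\Bbbk$, $\Bbbk=0,1,\dots$, be a sequence of unitary quantizations of $T_p$ (with respect to the partitions of $[0,1]$ into $N_\Bbbk=p^\Bbbk$ equal intervals), and let $(\psi_\Bbbk)$ be a sequence of normalized eigenvectors of the $U_\Bbbk$. Then the corresponding limiting invariant (semiclassical) measure $\mu=\lim_{\Bbbk\to\infty}\mu_\Bbbk$ satisfies $$H_{\mathrm{KS}}(T_p,\mu)\geq\sum_j\mu(I_j)\log\Lambda_j-\frac12\log\Lambda_{\max},\qquad\Lambda_{\max}=\max_j\Lambda_j.$$
   Context: Condition 1: $[0,1]$ is divided into consecutive intervals $I_1,\dots,I_l$ with $|I_j|=\Lambda_j^{-1}$ and $T_p$ is affine with slope $\Lambda_j$ on $I_j$ mapping $I_j$ onto $[0,1]$. Let $E_i=[(i-1)/N_\Bbbk,i/N_\Bbbk]$ and $B_\Bbbk(i,j)=|E_i\cap T_p^{-1}E_j|/|E_i|$; a quantization is a unitary $N_\Bbbk\times N_\Bbbk$ matrix $U_\Bbbk$ with $B_\Bbbk(j,i)=|U_\Bbbk(i,j)|^2$ for all $i,j$. $\mathrm{Op}_\Bbbk(f)$ is the diagonal matrix with $(i,i)$ entry $N_\Bbbk\int_{E_i}f\,dx$, and $\mu_\Bbbk$ is the probability measure with $\int f\,d\mu_\Bbbk=\langle\psi_\Bbbk,\mathrm{Op}_\Bbbk(f)\psi_\Bbbk\rangle$;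 $\mu$ is a weak-* limit of the $\mu_\Bbbk$. $H_{\mathrm{KS}}$ is Kolmogorov–Sinai entropy. *)

(* Defs.v *)
From HB Require Import structures.
From mathcomp Require Import all_boot all_order all_algebra.
From mathcomp Require Import all_classical all_reals all_analysis.
From mathcomp.real_closed Require Import complex.
Set Implicit Arguments. Unset Strict Implicit. Unset Printing Implicit Defensive.
Import Order.TTheory GRing.Theory Num.Theory.
Import numFieldNormedType.Exports.
Local Open Scope classical_set_scope.
Local Open Scope ring_scope.

Section Defs.
Variable R : realType.

Definition cmod2 (z : R[i]) : R := (complex.Re z) ^+ 2 + (complex.Im z) ^+ 2.

Definition unitary_mx (N : nat) (U : 'M[R[i]]_N) : Prop :=
  U *m (map_mx Num.conj U)^T = 1%:M.

Definition Lam (p l : nat) (n : 'I_l -> nat) (j : 'I_l) : R := (p ^ n j)%:R.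

Definition aI (p l : nat) (n : 'I_l -> nat) (j : 'I_l) : R :=
  \sum_(i < l | (i < j)%N) (Lam p n i)^-1.

Definition Iint (p l : nat) (n : 'I_l -> nat) (j : 'I_l) : set R :=
  if (j.+1 == l)%N then [set` `[aI p n j, aI p n j + (Lam p n j)^-1]]
  else [set` `[aI p n j, aI p n j + (Lam p n j)^-1[].

(** T_p x = Lambda_j (x - a_j) on I_j (and 0 outside [0,1]) *)
Definition Tp (p l : nat) (n : 'I_l -> nat) (x : R) : R :=
  \sum_(j < l) \1_(Iint p n j) x * (Lam p n j * (x - aI p n j)).

(** E_i = [i/N, (i+1)/N], i = 0..N-1 (0-indexed version of [(i-1)/N, i/N]) *)
Definition Ecell (N : nat) (i : 'I_N) : set R :=
  [set` `[(i%:R / N%:R), (i.+1%:R / N%:R)]].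

Definition Bmx (N : nat) (T : R -> R) (i j : 'I_N) : R :=
  fine (lebesgue_measure (Ecell i `&` (T @^-1` Ecell j)))
  / fine (lebesgue_measure (Ecell i)).

Definition is_quantization (N : nat) (T : R -> R) (U : 'M[R[i]]_N) : Prop :=
  unitary_mx U /\ forall i j : 'I_N, Bmx T j i = cmod2 (U i j).

(** int f dmu_k = <psi, Op(f) psi> = sum_i |psi_i|^2 N int_{E_i} f dx *)
Definition semiclassical_int (N : nat) (psi : 'cV[R[i]]_N) (f : R -> R) : R :=
  \sum_(i < N) cmod2 (psi i ord0) * (N%:R * Rintegral lebesgue_measure (Ecell i) f).

Definition ent_fun (x : R) : R := if x == 0 then 0 else - (x * ln x).

Definition is_fin_partition (m : nat) (P : 'I_m -> set R) : Prop :=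
  (forall i, measurable (P i)) /\ trivIset setT P /\ \bigcup_i P i = setT.

Definition part_entropy (mu : {measure set R -> \bar R}) (m : nat)
    (P : 'I_m -> set R) : R :=
  \sum_(i < m) ent_fun (fine (mu (P i))).

(** H( P v T^-1 P v ... v T^-(k-1) P ) ; cells indexed by words w *)
Definition join_entropy (mu : {measure set R -> \bar R}) (T : R -> R)
    (m : nat) (P : 'I_m -> set R) (k : nat) : R :=
  \sum_(w : {ffun 'I_k -> 'I_m})
     ent_fun (fine (mu (\bigcap_(t in [set: 'I_k]) ((iter t T) @^-1` P (w t))))).

Definition part_ks_entropy (mu : {measure set R -> \bar R}) (T : R -> R)
    (m : nat) (P : 'I_m -> set R) : R :=
  limn ((fun k : nat => join_entropy mu T P k.+1 / k.+1%:R) : R^nat).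

Definition ks_entropy (mu : {measure set R -> \bar R}) (T : R -> R) : \bar R :=
  ereal_sup [set ((part_ks_entropy mu T (projT2 P))%:E) | P in
     [set P : {m : nat & 'I_m -> set R} | is_fin_partition (projT2 P)]].
End Defs.

(* Main.v *)
Require Import Defs.
From HB Require Import structures.
From mathcomp Require Import all_boot all_order all_algebra.
From mathcomp Require Import all_classical all_reals all_analysis.
From mathcomp.real_closed Require Import complex.
From mathcomp Require Import measurable_realfun.
From mathcomp Require Import ring lra.
Set Implicit Arguments. Unset Strict Implicit. Unset Printing Implicit Defensive.
Import Order.TTheory GRing.Theory Num.Theory.
Import numFieldNormedType.Exports.
Local Open Scope classical_set_scope.
Local Open Scope ring_scope.

(* Let N = p^k. A word w of length m is the itinerary of points in an interval
   C_w of length 1/L_w, where L_w is the product of the slopes, and for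
   m max_j n_j <= k every C_w is a union of cells E_i. The matrix U sends a
   basis vector of E_j to a combination of the E_i inside T(E_j), so cylinder
   projections satisfy Egorov's identity exactly and the masses of cylinders
   under |psi|^2 are stationary. On vectors supported in C_w, U^m is dispersive:
   |(U^m v)_i|^2 <= |v|^2 / L_w. Combined with #C_w = N / L_w, a weighted
   entropic uncertainty principle for psi and U^m psi = z^m psi gives
     H_m(psi) >= sum_w |psi_w|^2 log L_w - (k/2) log p.
   Taking m close to k / max_j n_j, subadditivity brings the bound down to words
   of a fixed length m, and it passes to the limit k -> oo since the masses of
   cylinders converge: near an endpoint of C_w (other than 0 and 1) the
   itinerary escapes to one of the fixed points 0 and 1 of T, and stationarity
   makes the mass of such points small uniformly in k. *)

(** * Isometries and operator monotonicity of the logarithm *)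

(** The weights [L w] are what makes the local slopes appear: cylinders of one length m differ
    widely in size, and an unweighted uncertainty principle would retain only the worst of them. The
    weighted form starts from an inequality between quadratic forms, into which the logarithm is
    carried by operator monotonicity. Since U^m psi has the same moduli as psi, the two entropies of
    the uncertainty principle coincide; this is the origin of the factor 1/2. The length m cannot
    exceed k / max_j n_j by this method, because cells of size p^-k must resolve every C_w; at that
    length (k/2) log p is m times (1/2) log Lambda_max. In the limit the obstacle is that indicators
    of cylinders are discontinuous and the limit measure may charge 0 and 1. Only upper bounds on
    the limiting masses of cylinders are proved directly; as the masses sum to 1 both before and
    after the limit, upper bounds are enough. *)

Section SquaredModulus.
Variable R : realType.
Implicit Types z w : R[i].

Lemma cmod2_ge0 z : 0 <= cmod2 z.
Proof. by rewrite addr_ge0 ?sqr_ge0. Qed.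

Lemma cmod2_0 : cmod2 (0 : R[i]) = 0.
Proof. by rewrite /cmod2 /= expr0n addr0. Qed.

Lemma cmod2_eq0 z : (cmod2 z == 0) = (z == 0).
Proof.
by case: z => a b; rewrite /cmod2 /= paddr_eq0 ?sqr_ge0// !sqrf_eq0 eq_complex.
Qed.

Lemma cmod2M z w : cmod2 (z * w) = cmod2 z * cmod2 w.
Proof. by case: z => a b; case: w => c d; rewrite /cmod2 /=; ring. Qed.

Lemma cmod2E z : (cmod2 z)%:C%C = Num.conj z * z.
Proof.
case: z => a b; apply/eqP; rewrite eq_complex /cmod2 /=; apply/andP.
by split; apply/eqP; ring.
Qed.

Lemma Re_sum (I : finType) (F : I -> R[i]) :
  complex.Re (\sum_i F i) = \sum_i complex.Re (F i).
Proof.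
apply: (big_ind2 (fun z r => complex.Re z = r)) => //.
by move=> [? ?] ? [? ?] ? <- <-.
Qed.

Lemma Im_sum (I : finType) (F : I -> R[i]) :
  complex.Im (\sum_i F i) = \sum_i complex.Im (F i).
Proof.
apply: (big_ind2 (fun z r => complex.Im z = r)) => //.
by move=> [? ?] ? [? ?] ? <- <-.
Qed.

(** Weighted Cauchy-Schwarz, from the nonnegativity of the weighted variance of [a i / c i]. *)
Lemma sqr_sum_le (I : finType) (a c : I -> R) : (forall i, 0 < c i) ->
  (\sum_i a i) ^+ 2 <= (\sum_i c i) * \sum_i (a i ^+ 2 / c i).
Proof.
move=> c0; set A := \sum_i a i; set C := \sum_i c i.
have C0 : 0 <= C by apply: sumr_ge0 => i _; exact: ltW.
have : 0 <= \sum_i c i * (C * (a i / c i) - A) ^+ 2.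
  by apply: sumr_ge0 => i _; rewrite mulr_ge0 ?sqr_ge0// ltW.
have -> : \sum_i c i * (C * (a i / c i) - A) ^+ 2 =
    C ^+ 2 * (\sum_i (a i ^+ 2 / c i)) - 2 * C * A * A + A ^+ 2 * C.
  under eq_bigr => i _.
    have -> : c i * (C * (a i / c i) - A) ^+ 2 =
      C ^+ 2 * (a i ^+ 2 / c i) - 2 * C * A * a i + A ^+ 2 * c i.
      by field; exact: lt0r_neq0.
    over.
  by rewrite big_split sumrB -!mulr_sumr.
move=> H; have : 0 <= C * (C * (\sum_i (a i ^+ 2 / c i)) - A ^+ 2) by nra.
have [C1|C1] := ltP 0 C; first by rewrite pmulr_rge0// subr_ge0.
(* Every [c i] is positive, so [C = 0] means that [I] is empty. *)
have {}C1 : C = 0 by apply/eqP; rewrite eq_le C0 C1.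
move=> _; suff -> : A = 0 by rewrite C1 expr0n mul0r.
apply: big1 => i _; exfalso; move: C1 => /eqP; apply/negP/lt0r_neq0.
rewrite /C (bigD1 i)//= ltr_pwDl// sumr_ge0// => j _; exact: ltW.
Qed.

Lemma cmod2_sum_le (I : finType) (z : I -> R[i]) (c : I -> R) :
  (forall i, 0 < c i) ->
  cmod2 (\sum_i z i) <= (\sum_i c i) * \sum_i (cmod2 (z i) / c i).
Proof.
move=> c0; rewrite /cmod2 Re_sum Im_sum.
under [X in _ <= _ * X]eq_bigr do rewrite mulrDl.
by rewrite big_split mulrDr lerD// sqr_sum_le.
Qed.

End SquaredModulus.

Section Isometries.
Variables (R : realType) (N : nat).
Implicit Types (u v : 'cV[R[i]]_N) (V : 'M[R[i]]_N).

Definition nrm2 v : R := \sum_i cmod2 (v i ord0).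

Definition is_isometry V := forall v, nrm2 (V *m v) = nrm2 v.

Lemma nrm2E v : (nrm2 v)%:C%C = ((map_mx Num.conj v)^T *m v) ord0 ord0.
Proof.
rewrite /nrm2 rmorph_sum mxE; apply: eq_bigr => i _.
by rewrite !mxE -cmod2E.
Qed.

Lemma unitary_mx_isometry V : unitary_mx V -> is_isometry V.
Proof.
move=> UV v; apply: complexI; rewrite !nrm2E map_mxM trmx_mul.
by rewrite -mulmxA [X in _ *m X]mulmxA (mulmx1C UV) mul1mx.
Qed.

Lemma unitary_mx_col V j : unitary_mx V -> \sum_i cmod2 (V i j) = 1.
Proof.
move=> UV; have := mulmx1C UV => /(congr1 (fun A : 'M[R[i]]_N => A j j)).
rewrite [RHS]mxE eqxx => E; apply: complexI; rewrite rmorph1; transitivity (true%:R : R[i]) => //.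
rewrite -E mxE rmorph_sum.
by apply: eq_bigr => i _; rewrite !mxE -cmod2E.
Qed.

(** Real part of the Hermitian product, the polarization of [nrm2]. *)
Definition rdot u v : R := \sum_i (complex.Re (u i ord0) * complex.Re (v i ord0)
  + complex.Im (u i ord0) * complex.Im (v i ord0)).

Lemma nrm2D u v : nrm2 (u + v) = nrm2 u + nrm2 v + 2 * rdot u v.
Proof.
rewrite /nrm2 /rdot mulr_sumr -!big_split; apply: eq_bigr => i _ /=.
rewrite mxE; case: (u i ord0) => a b; case: (v i ord0) => c d.
by rewrite /cmod2 /=; ring.
Qed.

Lemma isometry_rdot V u v : is_isometry V -> rdot (V *m u) (V *m v) = rdot u v.
Proof.
move=> IV; have := IV (u + v); rewrite mulmxDr !nrm2D !IV => H; lra.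
Qed.

Lemma isometryM V W : is_isometry V -> is_isometry W -> is_isometry (V *m W).
Proof. by move=> IV IW v; rewrite -mulmxA IV IW. Qed.

End Isometries.

Section LogMonotone.
Variables (R : realType).

(** Integrates the resolvent inequalities over [t] without an integral: [F] has a nonnegative
    derivative, and it is bounded above by a multiple of 1/t because the equal totals cancel the
    terms in log t. Hence F(0) <= 0. *)
Lemma sum_ln_le (N : nat) (a x b y : 'I_N -> R) :
  (forall i, 0 <= a i) -> (forall i, 0 <= b i) ->
  (forall i, 0 < x i) -> (forall i, 0 < y i) ->
  \sum_i a i = \sum_i b i ->
  (forall t : R, 0 <= t -> \sum_i b i / (y i + t) <= \sum_i a i / (x i + t)) ->
  \sum_i a i * ln (x i) <= \sum_i b i * ln (y i).
Proof.
move=> a0 b0 x0 y0 ab H.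
pose F (t : R) := \sum_i (a i * ln (x i + t) - b i * ln (y i + t)).
have dF (t : R) : 0 <= t ->
    is_derive t 1 F (\sum_i (a i / (x i + t) - b i / (y i + t))).
  move=> t0.
  have -> : F = \sum_i (fun t => a i * ln (x i + t) - b i * ln (y i + t)).
    by apply/funext => s; rewrite fct_sumE.
  apply: is_derive_sum => i.
  have D (z : R) : 0 < z -> is_derive t 1 (fun t => ln (z + t)) (z + t)^-1.
    move=> z0; have zt : 0 < z + t by rewrite ltr_wpDr.
    have := @is_derive1_comp R (@ln R) (fun t => z + t) t _ 1 (is_derive1_ln zt).
    rewrite mulr1; apply.
    by have := is_deriveD (is_derive_cst z t 1) (is_derive_id t (1 : R)); rewrite add0r.
  have Dx := D _ (x0 i); have Dy := D _ (y0 i).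
  have := is_deriveB (is_deriveZ (a i) Dx) (is_deriveZ (b i) Dy).
  by [].
have mono t : 0 < t -> F 0 <= F t.
  move=> t0; apply: (@ger0_derive1_le_cc R F 0 t); rewrite ?in_itv /= ?lexx ?(ltW t0)//.
  - move=> s; rewrite in_itv /= => /andP[s0 _].
    by apply: ex_derive; exact: (dF s (ltW s0)).
  - move=> s; rewrite in_itv /= => /andP[s0 _].
    have E := dF s (ltW s0).
    rewrite derive1E derive_val sumrB subr_ge0; exact: H (ltW s0).
  - apply: derivable_within_continuous => s; rewrite in_itv /= => /andP[s0 _].
    by apply: ex_derive; exact: (dF s s0).
have bnd t : 0 < t -> F t <= (\sum_i a i * x i) / t.
  move=> t0.
  have lnE (z : R) : 0 < z -> ln (z + t) = ln t + ln (1 + z / t).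
    move=> z0; rewrite -lnM ?posrE// ?addr_gt0 ?divr_gt0//.
    by congr ln; field; rewrite lt0r_neq0.
  have -> : F t = \sum_i (a i * ln (1 + x i / t) - b i * ln (1 + y i / t)).
    rewrite /F !sumrB.
    under eq_bigr do rewrite lnE// mulrDr.
    under [X in _ - X = _]eq_bigr do rewrite lnE// mulrDr.
    rewrite !big_split /= -!mulr_suml ab; ring.
  rewrite mulr_suml; apply: ler_sum => i _.
  rewrite lerBlDr -[leLHS]addr0 lerD//.
    rewrite -mulrA ler_wpM2l// le_ln1Dx//.
    by rewrite (lt_trans (ltrN10 R))// divr_gt0.
  by rewrite mulr_ge0// ln_ge0// lerDl ltW// divr_gt0.
rewrite -subr_le0 -sumrB.
have -> : \sum_i (a i * ln (x i) - b i * ln (y i)) = F 0.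
  by apply: eq_bigr => i _; rewrite !addr0.
set S := \sum_i a i * x i in bnd.
have S0 : 0 <= S by apply: sumr_ge0 => i _; rewrite mulr_ge0// ltW.
rewrite leNgt; apply/negP => F0.
(* At this [t] the upper bound S / t falls below F(0). *)
have t0 : 0 < (S + 1) / F 0 by rewrite divr_gt0// ltr_wpDl.
have := le_trans (mono _ t0) (bnd _ t0).
rewrite invf_div mulrA ler_pdivlMr; last lra.
by rewrite mulrC mulrDl mul1r gerDl leNgt F0.
Qed.

(* Operator monotonicity of the logarithm, for two positive operators that are
   diagonal in orthonormal bases exchanged by V: inversion reverses the order
   of operators, and log z is the integral of 1/(1+t) - 1/(z+t). *)
Lemma isometry_ln_le (N : nat) (V : 'M[R[i]]_N) (psi : 'cV[R[i]]_N)
    (x y : 'I_N -> R) :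
  is_isometry V -> (forall i, 0 < x i) -> (forall i, 0 < y i) ->
  (forall v : 'cV[R[i]]_N, \sum_i x i * cmod2 ((V *m v) i ord0) <=
             \sum_i y i * cmod2 (v i ord0)) ->
  \sum_i cmod2 ((V *m psi) i ord0) * ln (x i) <=
  \sum_i cmod2 (psi i ord0) * ln (y i).
Proof.
move=> IV x0 y0 H; apply: sum_ln_le => //; try by move=> ?; exact: cmod2_ge0.
  exact: IV.
move=> t t0.
have xt i : 0 < x i + t by rewrite ltr_wpDr.
have yt i : 0 < y i + t by rewrite ltr_wpDr.
(* The resolvent of diag y applied to [psi]: for this vector both the pairing with [psi] and the
   quadratic form of y + t equal [S]. Young's inequality then yields 2 S <= S + (right-hand
   side). *)
set S := leLHS; pose v : 'cV[R[i]]_N := \col_i (((y i + t)^-1)%:C%C * psi i ord0).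
have E1 : rdot v psi = S.
  apply: eq_bigr => i _; rewrite mxE; case: (psi i ord0) => c d /=.
  by rewrite /cmod2 /=; ring.
have E2 : \sum_i (y i + t) * cmod2 (v i ord0) = S.
  apply: eq_bigr => i _; rewrite mxE cmod2M {1}/cmod2 /=.
  by field; rewrite lt0r_neq0.
have : 2 * rdot (V *m v) (V *m psi) <= \sum_i (x i + t) * cmod2 ((V *m v) i ord0)
    + \sum_i cmod2 ((V *m psi) i ord0) / (x i + t).
  rewrite mulr_sumr -big_split; apply: ler_sum => i _ /=.
  case: ((V *m v) i ord0) => a b; case: ((V *m psi) i ord0) => c d.
  rewrite /cmod2 /= -subr_ge0.
  move: (x i + t) (xt i) => X X0.
  have -> : X * (a ^+ 2 + b ^+ 2) + (c ^+ 2 + d ^+ 2) / X - 2 * (a * c + b * d)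
     = X * ((a - c / X) ^+ 2 + (b - d / X) ^+ 2).
    by field; rewrite lt0r_neq0.
  by rewrite mulr_ge0 ?addr_ge0 ?sqr_ge0// ltW.
rewrite isometry_rdot// E1.
have : \sum_i (x i + t) * cmod2 ((V *m v) i ord0) <= S.
  rewrite -E2.
  under eq_bigr do rewrite mulrDl.
  under [leRHS]eq_bigr do rewrite mulrDl.
  by rewrite !big_split lerD// -!mulr_sumr ler_wpM2l// -!/(nrm2 _) IV.
by move=> h1 h2; lra.
Qed.

End LogMonotone.

(** * Entropy of finite-valued observables and the uncertainty principle *)

Section Entropy.
Variables (R : realType) (J : finType) (rho : J -> R).
Hypothesis rho_ge0 : forall j, 0 <= rho j.

Definition mass (A : pred J) : R := \sum_(j | A j) rho j.

(** Shannon entropy as the mean of the information. In this form it visibly depends only on the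
    partition into level sets, and the values of [f] need not be enumerated. *)
Definition entropy (A : eqType) (f : J -> A) : R :=
  - \sum_j rho j * ln (mass (fun i => f i == f j)).

Lemma mass_ge0 A : 0 <= mass A.
Proof. by apply: sumr_ge0. Qed.

Lemma mass_sub (A B : pred J) : (forall j, A j -> B j) -> mass A <= mass B.
Proof.
move=> AB; rewrite /mass [leLHS]big_mkcond [leRHS]big_mkcond.
apply: ler_sum => j _; case: ifP => [/AB ->//|_]; by case: ifP.
Qed.

Lemma mass_disjoint (A B C : pred J) :
  (forall j, A j -> C j) -> (forall j, B j -> C j) -> (forall j, ~~ (A j && B j)) ->
  mass A + mass B <= mass C.
Proof.
move=> AC BC AB; rewrite /mass [in leLHS]big_mkcond [X in _ + X]big_mkcond.
rewrite -big_split [leRHS]big_mkcond; apply: ler_sum => j _ /=.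
have := AB j; case: (boolP (A j)) => [/AC -> /= /negbTE ->|_ _]; first by rewrite addr0.
by rewrite add0r; case: ifPn => [/BC -> //|_]; case: ifP.
Qed.

Lemma rho_le_mass (A : pred J) j : A j -> rho j <= mass A.
Proof. by move=> Aj; rewrite /mass (bigD1 j)//= lerDl sumr_ge0. Qed.

Lemma expectation_partition (A : finType) (f : J -> A) (h : A -> R) :
  \sum_j rho j * h (f j) = \sum_a mass (fun j => f j == a) * h a.
Proof.
rewrite (partition_big f xpredT)//=; apply: eq_bigr => a _.
by rewrite mulr_suml; apply: eq_bigr => j /eqP ->.
Qed.

Lemma sum_mass (A : finType) (f : J -> A) :
  \sum_a mass (fun j => f j == a) = \sum_j rho j.
Proof. by rewrite [RHS](partition_big f xpredT). Qed.

Lemma entropyE (A : finType) (f : J -> A) :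
  entropy f = \sum_a ent_fun (mass (fun j => f j == a)).
Proof.
rewrite /entropy (expectation_partition f (fun a => ln (mass (fun j => f j == a)))).
rewrite -sumrN; apply: eq_bigr => a _; rewrite /ent_fun.
by case: eqP => // ->; rewrite mul0r oppr0.
Qed.

Lemma eq_entropy (A B : eqType) (f : J -> A) (g : J -> B) :
  (forall i j, (f i == f j) = (g i == g j)) -> entropy f = entropy g.
Proof.
move=> fg; congr (- _); apply: eq_bigr => j _; congr (_ * ln _).
by apply: eq_bigl => i; exact: fg.
Qed.

Lemma eq_entropy_law (A : finType) (f g : J -> A) :
  (forall a, mass (fun j => f j == a) = mass (fun j => g j == a)) ->
  entropy f = entropy g.
Proof. by move=> fg; rewrite !entropyE; apply: eq_bigr => a _; rewrite fg. Qed.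

(** Nonnegativity of mutual information: ln u <= u - 1, where u is the ratio of the product of the
    marginals to the joint law, a variable of mean at most 1. *)
Lemma entropy_pair (A B : finType) (f : J -> A) (g : J -> B) :
  \sum_j rho j = 1 ->
  entropy (fun j => (f j, g j)) <= entropy f + entropy g.
Proof.
move=> rho1; rewrite /entropy -opprD lerN2 -big_split /=.
set F := fun a => mass (fun j => f j == a).
set G := fun b => mass (fun j => g j == b).
set P := fun ab => mass (fun j => (f j, g j) == ab).
have : \sum_j rho j * (F (f j) * G (g j) / P (f j, g j)) <= 1.
  rewrite (expectation_partition (fun j => (f j, g j))
    (fun ab => F ab.1 * G ab.2 / P ab)) -/P.
  (* Pairs of joint mass zero drop out on the left only, hence an inequality. *)
  apply: (@le_trans _ _ (\sum_ab F ab.1 * G ab.2)).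
    apply: ler_sum => ab _; have [P0|P0] := eqVneq (mass (fun j => (f j, g j) == ab)) 0.
      by rewrite P0 mul0r mulr_ge0 ?mass_ge0.
    by rewrite mulrC divfK.
  rewrite -(pair_big xpredT xpredT (fun a b => F a * G b))/=.
  under eq_bigr do rewrite -mulr_sumr.
  by rewrite -mulr_suml !sum_mass rho1 mulr1.
move=> H; rewrite -subr_le0 -sumrB; apply: le_trans (_ : 1 - 1 <= _); last by rewrite subrr.
apply: le_trans (lerB H (lexx 1)); rewrite -[X in _ - X]rho1 -sumrB.
apply: ler_sum => j _; rewrite -mulrDr -mulrBr -[X in _ <= _ - X]mulr1 -mulrBr.
have [->|rj] := eqVneq (rho j) 0; first by rewrite !mul0r.
have rj0 : 0 < rho j by rewrite lt_neqAle eq_sym rj rho_ge0.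
have F0 : 0 < F (f j) by rewrite (lt_le_trans rj0)// rho_le_mass.
have G0 : 0 < G (g j) by rewrite (lt_le_trans rj0)// rho_le_mass.
have P0 : 0 < P (f j, g j) by rewrite (lt_le_trans rj0)// rho_le_mass.
rewrite ler_pM2l// -lnM ?posrE// -ln_div ?posrE ?mulr_gt0//.
rewrite -[X in ln X](subrK 1) addrC; apply: le_ln1Dx.
by rewrite ltrBrDl subrr divr_gt0// mulr_gt0.
Qed.

End Entropy.

(** * A weighted entropic uncertainty principle *)

Section Uncertainty.
Variables (R : realType) (N : nat) (W : finType).
Variables (V : 'M[R[i]]_N) (psi : 'cV[R[i]]_N) (f : 'I_N -> W) (L : W -> R).
Let rho j : R := cmod2 (psi j ord0).
Hypothesis V_isometry : is_isometry V.
Hypothesis psi1 : nrm2 psi = 1.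
Hypothesis Vpsi : forall j, cmod2 ((V *m psi) j ord0) = rho j.
Hypothesis L_gt0 : forall w, 0 < L w.
Hypothesis N_gt0 : (0 < N)%N.
Hypothesis V_dispersive : forall w (v : 'cV_N), (forall j, f j != w -> v j ord0 = 0) ->
  forall i, cmod2 ((V *m v) i ord0) <= nrm2 v / L w.
Hypothesis f_card : forall w, (\sum_(j | f j == w) 1) * L w <= N%:R.

(* The weights c w exceed the masses of the cells by eps only to keep
   them positive. *)
Let weighted_bound (c : W -> R) (v : 'cV[R[i]]_N) : (forall w, 0 < c w) ->
  \sum_i c (f i) * L (f i) / N%:R * cmod2 ((V *m v) i ord0) <=
  \sum_j (\sum_w c w) ^+ 2 / (c (f j) * L (f j)) * cmod2 (v j ord0).
Proof.
move=> c0; set C := \sum_w c w.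
have N0 : 0 < N%:R :> R by rewrite ltr0n.
have C0 : 0 <= C by apply: sumr_ge0 => w _; exact: ltW.
pose vw w : 'cV[R[i]]_N := \col_j (if f j == w then v j ord0 else 0).
have vE : v = \sum_w vw w.
  apply/colP => j; rewrite summxE (bigD1 (f j))//= mxE eqxx big1 ?addr0// => w.
  by rewrite mxE eq_sym => /negbTE ->.
pose B := \sum_w nrm2 (vw w) / L w / c w.
(* Cauchy-Schwarz with weights [c w] over the pieces of [v], then dispersion on each piece: a bound
   uniform in [i]. *)
have Vv i : cmod2 ((V *m v) i ord0) <= C * B.
  rewrite {1}vE mulmx_sumr summxE; apply: le_trans (cmod2_sum_le _ c0) _.
  rewrite ler_wpM2l//; apply: ler_sum => w _.
  rewrite ler_wpM2r ?invr_ge0 ?(ltW (c0 w))//; apply: V_dispersive => j.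
  by rewrite mxE => /negbTE ->.
have B0 : 0 <= B.
  apply: sumr_ge0 => w _; rewrite !divr_ge0 ?(ltW (c0 _)) ?(ltW (L_gt0 _))//.
  by apply: sumr_ge0 => j _; exact: cmod2_ge0.
(* The cell count [f_card] cancels [L w / N], so the left-hand weights have total at most [C]. *)
have X1 : \sum_i c (f i) * L (f i) / N%:R <= C.
  rewrite (partition_big f xpredT)//=; apply: ler_sum => w _.
  rewrite (eq_bigr (fun=> 1 * (c w * L w / N%:R))); last first.
    by move=> i /eqP ->; rewrite mul1r.
  rewrite -mulr_suml; have := f_card w; move: (\sum_(j | f j == w) 1) => S SN.
  have -> : S * (c w * L w / N%:R) = c w * (S * L w / N%:R) by ring.
  by rewrite ger_pMr// ler_pdivrMr// mul1r.
apply: (@le_trans _ _ (\sum_i c (f i) * L (f i) / N%:R * (C * B))).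
  apply: ler_sum => i _; rewrite ler_wpM2l//.
  by rewrite !mulr_ge0 ?invr_ge0 ?(ltW (c0 _)) ?(ltW (L_gt0 _)).
rewrite -mulr_suml; apply: (@le_trans _ _ (C * (C * B))).
  by rewrite ler_wpM2r// mulr_ge0.
rewrite mulrA -expr2 /B mulr_sumr [leRHS](partition_big f xpredT)//=.
apply: ler_sum => w _.
rewrite [leRHS](eq_bigr (fun j => C ^+ 2 / (c w * L w) * cmod2 (v j ord0))); last first.
  by move=> j /eqP ->.
rewrite -mulr_sumr.
have -> : nrm2 (vw w) = \sum_(j | f j == w) cmod2 (v j ord0).
  rewrite /nrm2 [RHS]big_mkcond; apply: eq_bigr => j _; rewrite mxE.
  by case: ifP => // _; exact: cmod2_0.
by rewrite invfM le_eqVlt; apply/orP; left; apply/eqP; ring.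
Qed.

(* Entropic uncertainty in the manner of Maassen and Uffink, with weights L. *)
Lemma entropic_uncertainty :
  2 * (\sum_j rho j * ln (L (f j)) - entropy rho f) <= ln N%:R.
Proof.
have rho0 j : 0 <= rho j by exact: cmod2_ge0.
have N0 : 0 < N%:R :> R by rewrite ltr0n.
pose m w := mass rho (fun j => f j == w).
have m0 w : 0 <= m w by exact: mass_ge0.
apply/ler_addgt0Pr => e e0.
(* Makes the normalization error 2 ln C, which is at most 2 eps #|W|, no larger than [e]. *)
pose eps := e / (2 * #|W|.+1%:R).
have eps0 : 0 < eps by rewrite divr_gt0// mulr_gt0// ltr0n.
pose c w := m w + eps.
have c0 w : 0 < c w by rewrite ltr_wpDl.
set C := \sum_w c w.
have CE : C = 1 + eps * #|W|%:R.
  by rewrite /C big_split /= sum_mass -/(nrm2 psi) psi1 sumr_const mulr_natr.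
have C1 : 1 <= C by rewrite CE lerDl mulr_ge0// ltW.
have C0 : 0 < C by exact: lt_le_trans C1.
have lnC : 2 * ln C <= e.
  apply: (@le_trans _ _ (2 * (eps * #|W|%:R))).
    by rewrite ler_pM2l// CE le_ln1Dx// (lt_le_trans (ltrN10 R))// mulr_ge0// ltW.
  rewrite /eps -[#|W|.+1%:R]natr1; have : 0 <= #|W|%:R :> R by []; move: (#|W|%:R) => k k0.
  have -> : 2 * (e / (2 * (k + 1)) * k) = e * (k / (k + 1)) by field; lra.
  by rewrite ger_pMr// ler_pdivrMr; lra.
pose x i := c (f i) * L (f i) / N%:R.
pose y i := C ^+ 2 / (c (f i) * L (f i)).
have x0 i : 0 < x i by rewrite divr_gt0// mulr_gt0.
have y0 i : 0 < y i by rewrite divr_gt0 ?exprn_gt0// mulr_gt0.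
have := isometry_ln_le psi V_isometry x0 y0 (fun v => weighted_bound v c0).
(* Both sides are now means under the same [rho]. The terms in log L and log c have opposite signs
   on the two sides, so they double when collected. *)
under eq_bigr do rewrite Vpsi.
have rhoC z : z = \sum_j rho j * z by rewrite -mulr_suml [X in X * _]psi1 mul1r.
have -> : \sum_i rho i * ln (x i) = \sum_i rho i * ln (L (f i))
    + \sum_i rho i * ln (c (f i)) - ln N%:R.
  rewrite [ln N%:R]rhoC -big_split -sumrB /=.
  apply: eq_bigr => i _; rewrite /x ln_div ?posrE ?mulr_gt0// lnM ?posrE//; ring.
have -> : \sum_i cmod2 (psi i ord0) * ln (y i) = 2 * ln C
    - \sum_i rho i * ln (L (f i)) - \sum_i rho i * ln (c (f i)).
  rewrite [2 * ln C]rhoC -!sumrB.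
  apply: eq_bigr => i _; rewrite /y ln_div ?posrE ?exprn_gt0 ?mulr_gt0//.
  rewrite lnM ?posrE// lnXn// /rho; ring.
have : - entropy rho f <= \sum_i rho i * ln (c (f i)).
  rewrite /entropy opprK; apply: ler_sum => i _.
  have [->|ri] := eqVneq (rho i) 0; first by rewrite !mul0r.
  have ri0 : 0 < rho i by rewrite lt_neqAle eq_sym ri rho0.
  have mi : 0 < m (f i) by rewrite (lt_le_trans ri0)// rho_le_mass.
  by rewrite ler_pM2l// ler_ln ?posrE// lerDl ltW.
lra.
Qed.

End Uncertainty.

(** * The expanding map, its cylinders and p-adic cells *)

Section ExpandingMap.
Variables (R : realType) (p l : nat) (n : 'I_l.+1 -> nat).
Hypothesis p_ge2 : (2 <= p)%N.
Hypothesis sumV : \sum_(j < l.+1) ((p ^ n j)%:R : R)^-1 = 1.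

Local Notation T := (@Tp R p l.+1 n).
Local Notation L := (Lam R p n).
Local Notation a := (aI R p n).
Local Notation I := (@Iint R p l.+1 n).

Lemma Lam_gt0 j : 0 < L j.
Proof. by rewrite ltr0n expn_gt0 (ltnW p_ge2). Qed.

Lemma Lam_ge1 j : 1 <= L j.
Proof. by rewrite ler1n expn_gt0 (ltnW p_ge2). Qed.

Lemma LamV_gt0 j : 0 < (L j)^-1.
Proof. by rewrite invr_gt0 Lam_gt0. Qed.

(** Extends [a] beyond the last branch, so that right endpoints of branches are values of [A]
    too. *)
Let A (m : nat) : R := \sum_(i < l.+1 | (i < m)%N) (L i)^-1.

Let A_le m m' : (m <= m')%N -> A m <= A m'.
Proof.
move=> mm'; rewrite /A [leLHS]big_mkcond [leRHS]big_mkcond.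
apply: ler_sum => i _; case: ifPn => [im|_]; first by rewrite (leq_trans im).
by case: ifP => // _; exact: ltW (LamV_gt0 i).
Qed.

Let AS (j : 'I_l.+1) : A j.+1 = a j + (L j)^-1.
Proof.
rewrite /A (bigD1 j)//= addrC; congr (_ + _); apply: eq_bigl => i.
by rewrite ltnS [in RHS]ltn_neqAle andbC -val_eqE.
Qed.

Let A_last : A l.+1 = 1.
Proof. by rewrite -sumV; apply: eq_bigl => i; rewrite ltn_ord. Qed.

Lemma aI0 : a ord0 = 0.
Proof. by rewrite /aI big_pred0. Qed.

Lemma aI_ge0 j : 0 <= a j.
Proof. by rewrite -aI0; apply: (A_le (leq0n j)). Qed.

Lemma aI_le1 j : a j + (L j)^-1 <= 1.
Proof. by rewrite -AS -A_last A_le. Qed.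

Lemma aI_max : a ord_max + (L ord_max)^-1 = 1.
Proof. by rewrite -AS. Qed.

Lemma aI_lt (i j : 'I_l.+1) : (i < j)%N -> a i + (L i)^-1 <= a j.
Proof. by move=> ij; rewrite -AS; apply: A_le. Qed.

Lemma Iint_le j x : I j x -> a j <= x <= a j + (L j)^-1.
Proof.
by rewrite /Iint; case: ifP => _; rewrite /= in_itv //= => /andP[-> /ltW].
Qed.

Lemma Iint_co j x : a j <= x < a j + (L j)^-1 -> I j x.
Proof.
by rewrite /Iint; case: ifP => _; rewrite /= in_itv //= => /andP[-> /ltW].
Qed.

Lemma Iint_lt j x : I j x -> x < 1 -> a j <= x < a j + (L j)^-1.
Proof.
rewrite /Iint; case: ifP => [/eqP jl|_]; rewrite /= in_itv //= => /andP[-> _] x1.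
have -> : j = ord_max by apply: val_inj; case: jl.
by rewrite aI_max.
Qed.

Lemma Iint_uniq i j x : I i x -> I j x -> i = j.
Proof.
wlog ij : i j / (i < j)%N => [H Ii Ij|].
  have [ij|ij|/val_inj//] := ltngtP i j; first exact: H.
  by apply/esym; apply: H.
move=> Ii /Iint_le/andP[ajx _]; move: Ii; rewrite /Iint ifF; last first.
  by apply/negbTE; rewrite neq_ltn; apply/orP; left; rewrite (leq_ltn_trans ij).
rewrite /= in_itv /= => /andP[_ xi].
by have := lt_le_trans xi (le_trans (aI_lt ij) ajx); rewrite ltxx.
Qed.

Lemma Iint_cover x : 0 <= x <= 1 -> exists j, I j x.
Proof.
move=> /andP[x0]; rewrite le_eqVlt => /predU1P[->|].
  exists ord_max; rewrite /Iint /= eqxx /= in_itv /= aI_max lexx andbT.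
  by rewrite -aI_max lerDl ltW ?LamV_gt0.
rewrite -A_last; suff H m : (m <= l.+1)%N -> x < A m -> exists j, I j x.
  exact: H (leqnn _).
elim: m => [|m IH] ml.
  by rewrite {1}/A big_pred0// ltNge x0.
have [xm _|mx] := ltP x (A m); first exact: IH (ltnW ml) xm.
rewrite (AS (Ordinal ml)) => xm; exists (Ordinal ml); apply: Iint_co.
by rewrite mx.
Qed.

(* Points outside [0,1] are assigned to the first branch. *)
Definition branch (x : R) : 'I_l.+1 := odflt ord0 [pick j | `[< I j x >]].

Lemma branchE j x : I j x -> branch x = j.
Proof.
move=> Ij; rewrite /branch; case: pickP => [i /asboolP Ii|/(_ j)/asboolP//].
exact: Iint_uniq Ii Ij.
Qed.

Lemma branch_default x : (forall j, ~ I j x) -> branch x = ord0.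
Proof. by move=> H; rewrite /branch; case: pickP => // j /asboolP/H. Qed.

Lemma branchP x : 0 <= x <= 1 -> I (branch x) x.
Proof. by move=> /Iint_cover[j Ij]; rewrite (branchE Ij). Qed.

Lemma branch_co x : 0 <= x < 1 -> a (branch x) <= x < a (branch x) + (L (branch x))^-1.
Proof.
move=> /andP[x0 x1]; apply: Iint_lt => //.
by apply: branchP; rewrite x0 ltW.
Qed.

Lemma TpE j x : I j x -> T x = L j * (x - a j).
Proof.
move=> Ij; rewrite /Tp (bigD1 j)//= indicE mem_set// mul1r big1 ?addr0// => i ij.
by rewrite indicE memNset ?mul0r// => Ii; move: ij; rewrite (Iint_uniq Ii Ij) eqxx.
Qed.

Lemma Tp_co x : 0 <= x < 1 -> 0 <= T x < 1.
Proof.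
move=> x01; have /andP[ax xa] := branch_co x01.
rewrite (TpE (Iint_co (branch_co x01))) mulr_ge0 ?subr_ge0 ?(ltW (Lam_gt0 _))//=.
by rewrite mulrC -ltr_pdivlMr ?Lam_gt0// div1r ltrBlDl.
Qed.

Lemma iter_Tp_co t x : 0 <= x < 1 -> 0 <= iter t T x < 1.
Proof. by move=> x01; elim: t => //= t /Tp_co. Qed.

Lemma branch1 : branch 1 = ord_max.
Proof.
apply: branchE; rewrite /Iint /= eqxx /= in_itv /= aI_max lexx andbT.
by rewrite -aI_max lerDl ltW ?LamV_gt0.
Qed.

Lemma Tp1 : T 1 = 1.
Proof.
rewrite (TpE (branchP _)) ?lexx ?ler01// branch1 -{1}aI_max addrC addKr.
by rewrite divff ?lt0r_neq0 ?Lam_gt0.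
Qed.

(** * Cylinders and their affine charts *)

Definition in_cyl (w : nat -> 'I_l.+1) (m : nat) (x : R) : bool :=
  [forall t : 'I_m, branch (iter t T x) == w t].

Lemma in_cylP w m x :
  reflect (forall t, (t < m)%N -> branch (iter t T x) = w t) (in_cyl w m x).
Proof.
apply: (iffP forallP) => [H t tm|H t]; first by have /eqP := H (Ordinal tm).
by apply/eqP; apply: H.
Qed.

Lemma in_cyl_recr w m x :
  in_cyl w m.+1 x = in_cyl w m x && (branch (iter m T x) == w m).
Proof.
apply/in_cylP/andP => [H|[/in_cylP H /eqP Hm] t].
  by split; [apply/in_cylP => t tm; apply: H; exact: ltnW|apply/eqP; exact: H].
by rewrite ltnS leq_eqVlt => /predU1P[->//|]; exact: H.
Qed.

Lemma in_cyl_recl w m x :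
  in_cyl w m.+1 x = (branch x == w 0%N) && in_cyl (fun t => w t.+1) m (T x).
Proof.
apply/in_cylP/andP => [H|[/eqP H0 /in_cylP H] [//|t tm]].
  split; first by apply/eqP; exact: (H 0%N).
  by apply/in_cylP => t tm; rewrite -iterSr; exact: (H t.+1).
by rewrite iterSr H.
Qed.

Lemma in_cyl_cat w w' m m' x :
  in_cyl (fun t => if (t < m)%N then w t else w' (t - m)%N) (m + m') x =
  in_cyl w m x && in_cyl w' m' (iter m T x).
Proof.
apply/in_cylP/andP => [H|[/in_cylP H /in_cylP H'] t tm].
  split; apply/in_cylP => t tm.
    by rewrite H ?tm// (leq_trans tm)// leq_addr.
  by rewrite -iterD addnC H ?ltn_add2l// ltnNge leq_addr /= addKn.
case: ltnP => [|mt]; first exact: H.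
by rewrite -{1}(subnK mt) iterD H'// ltn_subLR.
Qed.

Lemma eq_in_cyl w w' m x : (forall t, (t < m)%N -> w t = w' t) ->
  in_cyl w m x = in_cyl w' m x.
Proof.
by move=> ww; apply: eq_forallb => t; rewrite ww.
Qed.

Definition itinerary (m : nat) (x : R) : {ffun 'I_m -> 'I_l.+1} :=
  [ffun t : 'I_m => branch (iter t T x)].

(** Cylinders are indexed by sequences on [nat], for which shifts and concatenations are immediate;
    finite words serve as summation indices. The default letter beyond length m is never read by
    [in_cyl]. *)
Definition word_of (m : nat) (w : {ffun 'I_m -> 'I_l.+1}) (t : nat) : 'I_l.+1 :=
  oapp w ord0 (insub t).

Lemma word_of_ord m (w : {ffun 'I_m -> 'I_l.+1}) (t : 'I_m) : word_of w t = w t.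
Proof. by rewrite /word_of insubT//= => tm; congr (w _); apply: val_inj. Qed.

Lemma word_of_itinerary m x t : (t < m)%N -> word_of (itinerary m x) t = branch (iter t T x).
Proof. by move=> tm; rewrite (word_of_ord _ (Ordinal tm)) ffunE. Qed.

Lemma itineraryE m x (w : {ffun 'I_m -> 'I_l.+1}) :
  (itinerary m x == w) = in_cyl (word_of w) m x.
Proof.
apply/eqP/in_cylP => [<- t tm|H]; first by rewrite word_of_itinerary.
by apply/ffunP => t; rewrite ffunE -word_of_ord H.
Qed.

Definition cyl_slope (w : nat -> 'I_l.+1) (m : nat) : R := \prod_(t < m) L (w t).

(** Left endpoint of C_w, obtained by composing the inverse branches: on C_w, T^m is x -> slope (x -
    left). *)
Definition cyl_left (w : nat -> 'I_l.+1) (m : nat) : R :=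
  \sum_(t < m) a (w t) / cyl_slope w t.

Lemma cyl_slope_gt0 w m : 0 < cyl_slope w m.
Proof. by apply: prodr_gt0 => t _; exact: Lam_gt0. Qed.

Lemma cyl_slopeS w m : cyl_slope w m.+1 = cyl_slope w m * L (w m).
Proof. by rewrite /cyl_slope big_ord_recr. Qed.

Lemma cyl_leftS w m : cyl_left w m.+1 = cyl_left w m + a (w m) / cyl_slope w m.
Proof. by rewrite /cyl_left big_ord_recr. Qed.

Lemma cyl_affineS w m x :
  cyl_slope w m.+1 * (x - cyl_left w m.+1) =
  L (w m) * (cyl_slope w m * (x - cyl_left w m) - a (w m)).
Proof.
by rewrite cyl_slopeS cyl_leftS; field; rewrite lt0r_neq0 ?cyl_slope_gt0.
Qed.

(** The half-open interval lies in the cylinder; [iter_Tp_affine] conversely places the cylinder in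
    the closed interval. The right endpoint stays undecided here, as it belongs to C_w only when it
    is 1. *)
Lemma cyl_affine_in w m x : 0 <= cyl_slope w m * (x - cyl_left w m) < 1 ->
  in_cyl w m x /\ iter m T x = cyl_slope w m * (x - cyl_left w m).
Proof.
elim: m x => [|m IH] x.
  rewrite /cyl_slope /cyl_left !big_ord0 mul1r subr0 => _; split => //.
  by apply/in_cylP.
rewrite cyl_affineS; set y := cyl_slope w m * _ => H.
have Iy : I (w m) y.
  apply: Iint_co; move: H; rewrite pmulr_rge0 ?Lam_gt0// subr_ge0 => /andP[-> /=].
  by rewrite mulrC -ltr_pdivlMr ?Lam_gt0// div1r ltrBlDl.
have y01 : 0 <= y < 1.
  move: H; rewrite pmulr_rge0 ?Lam_gt0// subr_ge0 => /andP[ay H].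
  rewrite (le_trans (aI_ge0 _) ay) /=; apply: lt_le_trans (aI_le1 (w m)).
  by move: H; rewrite mulrC -ltr_pdivlMr ?Lam_gt0// div1r ltrBlDl.
have [cx Tx] := IH _ y01; rewrite in_cyl_recr cx iterS Tx -/y.
by rewrite (branchE Iy) eqxx (TpE Iy).
Qed.

Lemma iter_Tp_affine w m x : 0 <= x <= 1 -> in_cyl w m x ->
  0 <= iter m T x <= 1 /\ iter m T x = cyl_slope w m * (x - cyl_left w m).
Proof.
move=> x01; elim: m => [|m IH].
  by rewrite /cyl_slope /cyl_left !big_ord0 mul1r subr0.
rewrite in_cyl_recr => /andP[/IH[y01 yE]] /eqP bw.
have Iy := branchP y01; rewrite iterS cyl_affineS -yE -bw (TpE Iy); split => //.
have /andP[ay ya] := Iint_le Iy.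
rewrite mulr_ge0 ?subr_ge0 ?(ltW (Lam_gt0 _))//=.
by rewrite mulrC -ler_pdivlMr ?Lam_gt0// div1r lerBlDl.
Qed.

Lemma ln_cyl_slope w m : ln (cyl_slope w m) = \sum_(t < m) ln (L (w t)).
Proof.
elim: m => [|m IH]; first by rewrite /cyl_slope !big_ord0 ln1.
by rewrite cyl_slopeS big_ord_recr/= lnM ?posrE ?cyl_slope_gt0 ?Lam_gt0// IH.
Qed.

Lemma cyl_left_min m : cyl_left (fun=> ord0) m = 0.
Proof. by apply: big1 => t _; rewrite aI0 mul0r. Qed.

Lemma cyl_left_max m :
  cyl_left (fun=> ord_max) m = 1 - (cyl_slope (fun=> ord_max) m)^-1.
Proof.
elim: m => [|m IH]; first by rewrite /cyl_left /cyl_slope !big_ord0 invr1 subrr.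
rewrite cyl_leftS IH cyl_slopeS invfM.
have -> : a ord_max = 1 - (L ord_max)^-1 by rewrite -aI_max addrK.
ring.
Qed.

Lemma eq_cyl_left w w' m : (forall t, (t < m)%N -> w t = w' t) ->
  cyl_left w m = cyl_left w' m.
Proof.
move=> ww; apply: eq_bigr => t _; rewrite ww//; congr (_ / _).
by apply: eq_bigr => s _; rewrite ww// (ltn_trans (ltn_ord s)).
Qed.

Lemma eq_cyl_slope w w' m : (forall t, (t < m)%N -> w t = w' t) ->
  cyl_slope w m = cyl_slope w' m.
Proof. by move=> ww; apply: eq_bigr => t _; rewrite ww. Qed.

Lemma in_cyl_max m : in_cyl (fun=> ord_max) m 1.
Proof.
apply/in_cylP => t _; suff -> : iter t T 1 = 1 by exact: branch1.
by elim: t => //= t ->; exact: Tp1.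
Qed.

(* floor (p^m x) = floor (p^m y) *)
Definition padic_eq (m : nat) (x y : R) : Prop :=
  forall z : int, (z%:~R <= (p ^ m)%:R * x) = (z%:~R <= (p ^ m)%:R * y).

Lemma padic_eq_sym m x y : padic_eq m x y -> padic_eq m y x.
Proof. by move=> xy z; rewrite xy. Qed.

Lemma padic_eq_trans m x y z : padic_eq m x y -> padic_eq m y z -> padic_eq m x z.
Proof. by move=> xy yz u; rewrite xy yz. Qed.

Lemma padic_eqW m m' x y : (m <= m')%N -> padic_eq m' x y -> padic_eq m x y.
Proof.
move=> mm' xy z; have := xy (z * (p ^ (m' - m))%:Z).
have p0 : 0 < (p ^ (m' - m))%:R :> R by rewrite ltr0n expn_gt0 (ltnW p_ge2).
have -> : (p ^ m')%:R = (p ^ (m' - m))%:R * (p ^ m)%:R :> R.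
  by rewrite -natrM -expnD subnK.
by rewrite intrM mulrC -!mulrA !ler_pM2l.
Qed.

Lemma padic_eq_grid k j x : 0 <= (p ^ k)%:R * x - j%:R < 1 ->
  padic_eq k x (j%:R / (p ^ k)%:R).
Proof.
have p0 : 0 < (p ^ k)%:R :> R by rewrite ltr0n expn_gt0 (ltnW p_ge2).
rewrite subr_ge0 ltrBlDl => /andP[jx xj] z; rewrite [X in _ = (_ <= X)]mulrC divfK ?lt0r_neq0//.
apply/idP/idP => [zx|zj]; last exact: le_trans jx.
have := le_lt_trans zx xj; rewrite natr1 !pmulrn ltr_int ler_int.
by rewrite intS addrC ltzD1.
Qed.

Definition nmax : nat := \max_(j < l.+1) n j.

Lemma n_le_nmax j : (n j <= nmax)%N.
Proof. exact: leq_bigmax. Qed.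

Lemma pexp_Lam m j : (nmax <= m)%N -> (p ^ m)%:R = (p ^ (m - n j))%:R * L j.
Proof.
by move=> mm; rewrite /Lam -natrM -expnD subnK// (leq_trans (n_le_nmax j)).
Qed.

Lemma aI_int m j : (nmax <= m)%N -> exists z : int, (p ^ m)%:R * a j = z%:~R.
Proof.
move=> mm; exists (\sum_(i < l.+1 | (i < j)%N) p ^ (m - n i))%:Z.
rewrite -pmulrn natr_sum /aI mulr_sumr; apply: eq_bigr => i _.
by rewrite (pexp_Lam i mm) mulfK// lt0r_neq0// Lam_gt0.
Qed.

(** For m >= [nmax] the endpoints of every branch are multiples of p^-m, so the first m digits
    decide the branch. *)
Lemma padic_eq_branch m x y : (nmax <= m)%N -> 0 <= x < 1 ->
  padic_eq m x y -> branch x = branch y.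
Proof.
move=> mm x01 xy; apply/esym/branchE/Iint_co.
have p0 : 0 < (p ^ m)%:R :> R by rewrite ltr0n expn_gt0 (ltnW p_ge2).
set j := branch x; have [z zE] := aI_int j mm.
have z'E : (p ^ m)%:R * (a j + (L j)^-1) = (z + (p ^ (m - n j))%:Z)%:~R.
  by rewrite mulrDr zE (pexp_Lam j mm) mulfK ?lt0r_neq0 ?Lam_gt0// intrD.
have := branch_co x01; rewrite -/j -(ler_pM2l p0) -[X in _ && X](ltr_pM2l p0).
by rewrite -[X in _ -> X && _](ler_pM2l p0) -[X in _ -> _ && X](ltr_pM2l p0)
  !ltNge z'E zE !xy.
Qed.

(** On a branch, T multiplies by p^(n_j) and subtracts a multiple of p^(n_j - m): exactly n_j digits
    are consumed. *)
Lemma padic_eq_Tp m x y : (nmax <= m)%N -> 0 <= x < 1 -> 0 <= y < 1 ->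
  padic_eq m x y -> padic_eq (m - n (branch x)) (T x) (T y).
Proof.
move=> mm x01 y01 xy z; have bxy := padic_eq_branch mm x01 xy.
rewrite (TpE (Iint_co (branch_co x01))) (TpE (Iint_co (branch_co y01))) -bxy.
set j := branch x; have [u uE] := aI_int j mm.
by rewrite !mulrA -(pexp_Lam j mm) !mulrBr uE !lerBrDr -intrD xy.
Qed.

(** Each letter costs at most [nmax] digits; this is the source of all conditions of the form K nmax
    <= k. *)
Lemma padic_eq_itinerary K m x y : (K * nmax <= m)%N -> 0 <= x < 1 -> 0 <= y < 1 ->
  padic_eq m x y ->
  forall t, (t < K)%N -> branch (iter t T x) = branch (iter t T y).
Proof.
elim: K m x y => // K IH m x y Km x01 y01 xy [_|t tK].
  by apply: padic_eq_branch x01 xy; rewrite (leq_trans _ Km)// leq_pmull.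
have mm : (nmax <= m)%N by rewrite (leq_trans _ Km)// leq_pmull.
rewrite !iterSr; apply: (IH (m - n (branch x))%N) => //; try exact: Tp_co.
  rewrite leq_subRL ?(leq_trans (n_le_nmax _))// (leq_trans _ Km)// mulSn.
  by rewrite leq_add2r n_le_nmax.
exact: padic_eq_Tp.
Qed.

End ExpandingMap.

(** * Quantized maps *)

Section MeasurableMap.
Variables (R : realType) (p l : nat) (n : 'I_l -> nat).

Lemma measurable_Iint j : measurable (@Iint R p l n j).
Proof. by rewrite /Iint; case: ifP => _; exact: measurable_itv. Qed.

Lemma measurable_Tp : measurable_fun setT (@Tp R p l n).
Proof.
apply: measurable_sum => j; apply: measurable_funM.
  exact: measurable_indic (measurable_Iint j).
apply: measurable_funM; first exact: measurable_cst.
by apply: measurable_funB; [exact: measurable_id|exact: measurable_cst].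
Qed.

Lemma measurable_iter_Tp t : measurable_fun setT (iter t (@Tp R p l n)).
Proof.
elim: t => [|t IH]; first exact: measurable_id.
exact: measurableT_comp measurable_Tp IH.
Qed.

End MeasurableMap.

Section QuantizedMap.
Variables (R : realType) (p l : nat) (n : 'I_l.+1 -> nat).
Hypothesis p_ge2 : (2 <= p)%N.
Hypothesis sumV : \sum_(j < l.+1) ((p ^ n j)%:R : R)^-1 = 1.
Variables (k : nat) (U : 'M[R[i]]_(p ^ k)).
Hypothesis quantU : is_quantization (Tp p n) U.

Local Notation T := (@Tp R p l.+1 n).
Local Notation L := (Lam R p n).
Local Notation a := (aI R p n).
Local Notation branch := (@branch R p l n).
Local Notation in_cyl := (@in_cyl R p l n).
Local Notation slope := (cyl_slope R p n).
Local Notation nmax := (nmax n).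
Local Notation N := (p ^ k)%N.

(** Left endpoint of E_j, used as the representative of the cell: short itineraries are constant on
    the half-open cell, but may change at its right endpoint. *)
Definition grid (j : 'I_(p ^ k)) : R := j%:R / (p ^ k)%:R.

Let N_gt0 : 0 < N%:R :> R.
Proof. by rewrite ltr0n expn_gt0 (ltnW p_ge2). Qed.

Let Lgt0 j : 0 < L j. Proof. exact: Lam_gt0. Qed.

Lemma grid_co j : 0 <= grid j < 1.
Proof.
by rewrite divr_ge0 ?ler0n// ltr_pdivrMr// mul1r ltr_nat ltn_ord.
Qed.

Lemma EcellE (j : 'I_N) (x : R) : Ecell j x -> 0 <= N%:R * x - j%:R <= 1.
Proof.
rewrite /Ecell /= in_itv /= ler_pdivrMr// ler_pdivlMr// ![x * _]mulrC.
by rewrite subr_ge0 lerBlDl natr1.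
Qed.

Let cell_right (j : nat) (x : R) : N%:R * x - j%:R = 1 -> x = j.+1%:R / N%:R.
Proof.
move=> xj; apply: (mulfI (lt0r_neq0 N_gt0)).
by rewrite mulrCA divff ?lt0r_neq0// mulr1 -natr1 -[X in _ + X]xj addrC subrK.
Qed.

Lemma half_open_co (j : 'I_N) (x : R) : 0 <= N%:R * x - j%:R < 1 -> 0 <= x < 1.
Proof.
rewrite subr_ge0 ltrBlDl natr1 => /andP[j0 xj].
rewrite -(pmulr_rge0 _ N_gt0) (le_trans (ler0n _ j))//=.
rewrite -(ltr_pM2l N_gt0) mulr1; apply: lt_le_trans xj _.
by rewrite ler_nat ltn_ord.
Qed.

Lemma Ecell_measure (j : 'I_N) :
  lebesgue_measure (Ecell j : set R) = (N%:R^-1)%:E.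
Proof.
rewrite /Ecell lebesgue_measure_itv /= lte_fin ltr_pM2r ?invr_gt0// ltr_nat ltnSn.
by rewrite -EFinB -mulrBl -natr1 [_ + 1]addrC addrK mul1r.
Qed.

Lemma measurable_transition (i j : 'I_N) :
  measurable (Ecell j `&` (T @^-1` Ecell i)).
Proof.
apply: measurableI; first exact: measurable_itv.
rewrite -[X in measurable X]setTI; apply: measurable_Tp => //.
exact: measurable_itv.
Qed.

(** A nonzero entry means that E_j meets T^-1 E_i in positive measure, which leaves room to avoid
    right endpoints. *)
Lemma quantization_neq0 i j : U i j != 0 ->
  exists x : R, 0 <= N%:R * x - j%:R < 1 /\ 0 <= N%:R * T x - i%:R < 1.
Proof.
move=> Uij; apply: contrapT => H; move: Uij; rewrite -cmod2_eq0.
case: quantU => _ <-; rewrite /Bmx.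
suff -> : lebesgue_measure (Ecell j `&` (T @^-1` Ecell i)) = 0%E.
  by rewrite /= mul0r eqxx.
apply: countable_lebesgue_measure0.
(* The right endpoint of E_j, and the preimages under each branch of the right endpoint of E_i. *)
pose F : set R := [set j.+1%:R / N%:R] `|`
  ((fun b => a b + i.+1%:R / N%:R / L b) @` [set: 'I_l.+1]).
apply: (@sub_countable _ _ _ F); last first.
  apply: finite_set_countable; rewrite finite_setU; split.
    exact: finite_set1.
  exact: finite_image.
apply: subset_card_le => x [Ej Ti].
have /andP[j0] := EcellE Ej; rewrite le_eqVlt => /predU1P[xj|xj].
  by left; exact: cell_right.
have /andP[i0] := EcellE Ti; rewrite le_eqVlt => /predU1P[xi|xi]; last first.
  by exfalso; apply: H; exists x; rewrite j0 xj i0 xi.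
right; exists (branch x) => //.
have x01 : 0 <= x < 1 by apply: (@half_open_co j); rewrite j0 xj.
have Tx : T x = i.+1%:R / N%:R by exact: cell_right.
rewrite -Tx (TpE p_ge2 (Iint_co (branch_co p_ge2 sumV x01))) mulrC.
by rewrite mulKf ?lt0r_neq0// subrKC.
Qed.

(** A cell lies in a single branch up to its right endpoint, so the part of it mapped into E_i has
    length at most 1 / (N L). *)
Lemma quantization_le i j : (nmax <= k)%N ->
  cmod2 (U i j) <= (L (branch (grid j)))^-1.
Proof.
move=> nk; case: quantU => _ <-; rewrite /Bmx Ecell_measure /= invrK.
set b := branch (grid j).
pose D : set R := `[a b + i%:R / N%:R / L b, a b + i.+1%:R / N%:R / L b]%classic
   `|` [set j.+1%:R / N%:R].
have mD : measurable D.
  by apply: measurableU; [exact: measurable_itv|exact: measurable_set1].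
have subD : Ecell j `&` (T @^-1` Ecell i) `<=` D.
  move=> x [Ej Ti].
  have /andP[j0] := EcellE Ej; rewrite le_eqVlt => /predU1P[xj|xj].
    by right; exact: cell_right.
  left; have x01 : 0 <= x < 1 by apply: (@half_open_co j); rewrite j0 xj.
  have xb : branch x = b.
    apply: (padic_eq_branch p_ge2 sumV nk x01); apply: padic_eq_grid => //.
    by rewrite j0.
  move: Ti; rewrite /Ecell /= !in_itv /=.
  rewrite (TpE p_ge2 (Iint_co (branch_co p_ge2 sumV x01))) xb => /andP[h1 h2].
  apply/andP; split; first by rewrite -lerBrDl ler_pdivrMr// [leRHS]mulrC.
  by rewrite -lerBlDl ler_pdivlMr// mulrC.
have mu_le : (lebesgue_measure (Ecell j `&` (T @^-1` Ecell i)) <=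
    ((N%:R * L b)^-1)%:E)%E.
  apply: le_trans (le_measure lebesgue_measure _ _ subD) _.
  - by rewrite inE; exact: measurable_transition.
  - by rewrite inE.
  apply: le_trans (measureU2 _ _ _) _; [exact: measurable_itv|exact: measurable_set1|].
  rewrite [X in (_ + X)%E]lebesgue_measure_set1 adde0.
  rewrite [X in (X <= _)%E]lebesgue_measure_itv /=.
  have lt : a b + i%:R / N%:R / L b < a b + i.+1%:R / N%:R / L b.
    by rewrite ltrD2l !ltr_pM2r ?invr_gt0// ltr_nat.
  rewrite lte_fin lt -EFinB lee_fin -natr1 le_eqVlt; apply/orP; left; apply/eqP.
  rewrite -/b; move: (N%:R : R) N_gt0 (L b) (Lgt0 b) => u u0 v v0.
  by field; rewrite !lt0r_neq0.
rewrite -[leRHS](_ : (N%:R * L b)^-1 * N%:R = _); last first.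
  rewrite -/b; move: (N%:R : R) N_gt0 (L b) (Lgt0 b) => u u0 v v0.
  by field; rewrite !lt0r_neq0.
rewrite ler_pM2r//; move: mu_le.
have inv0 : 0 <= (N%:R * L b)^-1 by rewrite invr_ge0 mulr_ge0// ltW.
by case: (lebesgue_measure _) => [r||]; rewrite ?lee_fin.
Qed.

(** Exact Egorov property at the level of matrix entries: U only links j to those i whose itinerary
    is that of j shifted by one letter. One digit block is lost in applying T, hence t + 1 < K. *)
Lemma quantization_itinerary K i j t : U i j != 0 -> (K * nmax <= k)%N ->
  (t.+1 < K)%N -> branch (iter t T (grid i)) = branch (iter t.+1 T (grid j)).
Proof.
move=> /quantization_neq0[x [xj xi]] Kk tK.
have x01 := half_open_co xj.
have nk : (nmax <= k)%N by rewrite (leq_trans _ Kk)// leq_pmull// (leq_ltn_trans _ tK).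
have g01 := grid_co.
have xg : padic_eq p k x (grid j) by apply: (padic_eq_grid p_ge2).
have Tx01 := half_open_co xi.
have Tg01 : 0 <= T (grid j) < 1 by exact: Tp_co.
have Txg := padic_eq_Tp p_ge2 sumV nk x01 (g01 j) xg.
have Tg : padic_eq p k (T x) (grid i) by apply: (padic_eq_grid p_ge2).
rewrite iterSr; apply: (padic_eq_itinerary p_ge2 sumV (K := K.-1)
  (m := (k - n (branch x))%N)) => //.
- rewrite leq_subRL ?(leq_trans (n_le_nmax _ _))//.
  rewrite (leq_trans _ Kk)// -[X in (_ <= X * _)%N](ltn_predK tK) mulSn.
  by rewrite leq_add2r n_le_nmax.
- by apply: padic_eq_trans Txg; apply: padic_eq_sym; apply: padic_eqW Tg => //; exact: leq_subr.
- by rewrite -ltnS (ltn_predK tK).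
Qed.

(** Integer slopes map the cells of one branch onto unions of whole cells with disjoint interiors. A
    row of U thus has at most one nonzero entry per branch. *)
Lemma quantization_inj i j j' : (nmax <= k)%N -> U i j != 0 -> U i j' != 0 ->
  branch (grid j) = branch (grid j') -> j = j'.
Proof.
wlog jj : j j' / (j < j')%N => [H|].
  move=> nk Uj Uj' b; have [jj|jj|/val_inj//] := ltngtP j j'; first exact: H.
  by apply/esym; apply: H.
move=> nk /quantization_neq0[x [xj xi]] /quantization_neq0[x' [xj' xi']] bjj.
have x01 := half_open_co xj; have x01' := half_open_co xj'.
have xb : branch x = branch (grid j).
  by apply: (padic_eq_branch p_ge2 sumV nk x01); apply: (padic_eq_grid p_ge2).
have xb' : branch x' = branch (grid j).
  by rewrite bjj; apply: (padic_eq_branch p_ge2 sumV nk x01'); apply: (padic_eq_grid p_ge2).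
move: xi xi'; rewrite (TpE p_ge2 (Iint_co (branch_co p_ge2 sumV x01))).
rewrite (TpE p_ge2 (Iint_co (branch_co p_ge2 sumV x01'))) xb xb'.
set b := branch (grid j); have [z zE] := aI_int R p_ge2 b nk.
have E y : N%:R * (L b * (y - a b)) = L b * (N%:R * y - z%:~R) by rewrite -zE; ring.
rewrite !E => /andP[xi _] /andP[_ xi'].
have L0 := Lgt0 b.
(* N times the image of (j+1)/N under the affine extension of branch [b]. This integer separates the
   images of the two cells, and would lie strictly between i and i + 1. *)
pose M : int := (p ^ n b)%:Z * (j.+1%:Z - z).
have ME : M%:~R = L b * (j.+1%:R - z%:~R) by rewrite intrM intrB.
have h1 : i%:R < M%:~R :> R.
  rewrite ME; apply: le_lt_trans (_ : L b * (N%:R * x - z%:~R) < _).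
    by rewrite -subr_ge0.
  rewrite ltr_pM2l// ltrD2r -natr1; move: xj => /andP[_]; rewrite ltrBlDl.
  by [].
have h2 : M%:~R < i.+1%:R :> R.
  rewrite ME; apply: (@le_lt_trans _ _ (L b * (N%:R * x' - z%:~R))).
    rewrite ler_pM2l// lerD2r; move: xj' => /andP[+ _]; rewrite subr_ge0.
    by apply: le_trans; rewrite ler_nat.
  by rewrite -natr1 -ltrBlDl.
move: h1 h2; rewrite !pmulrn !ltr_int intS addrC ltzD1 => h1 h2.
by have := lt_le_trans h1 h2; rewrite ltxx.
Qed.

Lemma quantization_row i b : (nmax <= k)%N ->
  (forall j, branch (grid j) = b -> U i j = 0) \/
  (exists2 j0, branch (grid j0) = b &
     forall j, branch (grid j) = b -> j != j0 -> U i j = 0).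
Proof.
move=> nk; case: (pickP (fun j => (branch (grid j) == b) && (U i j != 0))).
  move=> j0 /andP[/eqP bj0 Uj0]; right; exists j0 => // j bj; apply: contraNeq => Uj.
  by apply/eqP; apply: (@quantization_inj i) => //; rewrite bj.
move=> H; left => j bj; have := H j; rewrite bj eqxx /=.
by move/negbFE/eqP.
Qed.

(** * Propagation of cylinders by powers of the quantization *)

Definition qpow (m : nat) : 'M[R[i]]_(p ^ k) := iter m (mulmx U) 1%:M.

Lemma U_isometry : is_isometry U.
Proof. by apply: unitary_mx_isometry; case: quantU. Qed.

Lemma qpow_isometry m : is_isometry (qpow m).
Proof.
elim: m => [|m IH]; first by move=> v; rewrite mul1mx.
by apply: isometryM => //; exact: U_isometry.
Qed.

Lemma qpowS m (v : 'cV_(p ^ k)) : qpow m.+1 *m v = U *m (qpow m *m v).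
Proof. by rewrite /qpow iterS mulmxA. Qed.

(** Every application of U erases the first letter of the itinerary, so after s steps only the last
    m letters of w are left to constrain the support. *)
Lemma qpow_support w m s (v : 'cV[R[i]]_(p ^ k)) : ((m + s) * nmax <= k)%N ->
  (forall j, ~~ in_cyl w (m + s) (grid j) -> v j ord0 = 0) ->
  forall i, ~~ in_cyl (fun t => w (t + s)%N) m (grid i) -> (qpow s *m v) i ord0 = 0.
Proof.
elim: s m w => [|s IH] m w mk vw i.
  rewrite /qpow /= mul1mx => wi; apply: vw; rewrite addn0; apply: contraNN wi.
  by rewrite (@eq_in_cyl _ _ _ _ _ w)// => t _; rewrite addn0.
move=> wi; rewrite qpowS mxE big1// => j _.
have [->|Uij] := eqVneq (U i j) 0; first by rewrite mul0r.
rewrite (IH m.+1 w) ?mulr0//; rewrite ?addSnnS//.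
apply: contraNN wi => /in_cylP cj; apply/in_cylP => t tm.
rewrite (quantization_itinerary (K := m.+1) Uij) ?ltnS//.
  by rewrite cj ?ltnS// addSnnS.
by rewrite (leq_trans _ mk)// leq_mul2r addnS ltnS leq_addr orbT.
Qed.

(** Before each application of U the vector is supported in one branch. Each row of U then meets it
    in at most one entry, so there is no interference and the squared modulus gains a factor 1 /
    L. *)
Lemma qpow_dispersive w m (v : 'cV[R[i]]_(p ^ k)) : (m * nmax <= k)%N ->
  (forall j, ~~ in_cyl w m (grid j) -> v j ord0 = 0) ->
  forall i, cmod2 ((qpow m *m v) i ord0) <= nrm2 v / slope w m.
Proof.
elim: m => [|m IH] mk vw i.
  rewrite /qpow /= mul1mx /cyl_slope big_ord0 divr1 /nrm2 (bigD1 i)//=.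
  by rewrite lerDl sumr_ge0// => j _; exact: cmod2_ge0.
have nk : (nmax <= k)%N by rewrite (leq_trans _ mk)// leq_pmull.
have mk' : (m * nmax <= k)%N by rewrite (leq_trans _ mk)// leq_mul2r leqnSn orbT.
have {}IH := IH mk'; set u := qpow m *m v in IH *.
have ub j : branch (grid j) != w m -> u j ord0 = 0.
  move=> bj; apply: (@qpow_support w 1 m); rewrite ?add1n//.
  by apply: contraNN bj => /in_cylP/(_ 0%N isT) /= ->.
have {}IH j : cmod2 (u j ord0) <= nrm2 v / slope w m.
  apply: IH => j' wj'; apply: vw; apply: contraNN wj'.
  by rewrite in_cyl_recr => /andP[].
have slope0 := cyl_slope_gt0 R n p_ge2.
have v0 : 0 <= nrm2 v by apply: sumr_ge0 => j _; exact: cmod2_ge0.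
rewrite qpowS mxE; case: (quantization_row i (w m) nk) => [U0|[j0 bj0 U0]].
  rewrite big1 ?cmod2_0 ?divr_ge0 ?(ltW (slope0 _ _))// => j _.
  have [/U0 ->|/ub ->] := eqVneq (branch (grid j)) (w m); first by rewrite mul0r.
  by rewrite mulr0.
rewrite (bigD1 j0)//= big1 ?addr0 => [|j jj0]; last first.
  have [bj|/ub ->] := eqVneq (branch (grid j)) (w m); last by rewrite mulr0.
  by rewrite U0 ?mul0r.
rewrite cmod2M cyl_slopeS invfM mulrA mulrC ler_pM ?cmod2_ge0//.
by rewrite -bj0; exact: quantization_le.
Qed.

(** Counting through unitarity: each column has squared norm 1, while the rows reached lie in the
    shifted cylinder and carry at most 1 / L each. Removing the first letter thus costs a factor
    L. *)
Lemma card_cyl_le w m : (m * nmax <= k)%N ->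
  (\sum_(j | in_cyl w m (grid j)) 1) * slope w m <= N%:R.
Proof.
elim: m w => [|m IH] w mk.
  rewrite /cyl_slope big_ord0 mulr1 sumr_const ler_nat.
  by rewrite (leq_trans (max_card _))// card_ord.
have nk : (nmax <= k)%N by rewrite (leq_trans _ mk)// leq_pmull.
have mk' : (m * nmax <= k)%N by rewrite (leq_trans _ mk)// leq_mul2r leqnSn orbT.
apply: le_trans (IH (fun t => w t.+1) mk').
rewrite /cyl_slope big_ord_recl /= mulrA ler_wpM2r//.
  exact: (ltW (cyl_slope_gt0 R n p_ge2 (fun t => w t.+1) m)).
rewrite -ler_pdivlMr// mulr_suml.
have UU : unitary_mx U by case: quantU.
rewrite (eq_bigr (fun j => \sum_i cmod2 (U i j))) => [|j _]; last first.
  by rewrite unitary_mx_col.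
rewrite exchange_big [leRHS]big_mkcond; apply: ler_sum => i _ /=.
case: ifPn => [_|wi]; last first.
  rewrite big1// => j; rewrite in_cyl_recl => /andP[_ /in_cylP cj].
  have [->|Uij] := eqVneq (U i j) 0; first exact: cmod2_0.
  exfalso; move/negP: wi; apply; apply/in_cylP => t tm.
  by rewrite (quantization_itinerary (K := m.+1) Uij)// iterSr cj.
rewrite div1r; case: (quantization_row i (w 0%N) nk) => [U0|[j0 bj0 U0]].
  rewrite big1 ?invr_ge0 ?(ltW (Lgt0 _))// => j.
  by rewrite in_cyl_recl => /andP[/eqP/U0 -> _]; exact: cmod2_0.
apply: (@le_trans _ _ (cmod2 (U i j0))); last by rewrite -bj0 quantization_le.
rewrite big_mkcond (bigD1 j0)//= big1 ?addr0.
  by case: ifP => // _; exact: cmod2_ge0.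
move=> j jj0; case: ifP => //; rewrite in_cyl_recl => /andP[/eqP bj _].
by rewrite U0// cmod2_0.
Qed.

(** * Eigenvectors and stationarity of their masses *)

Variable psi : 'cV[R[i]]_(p ^ k).
Hypothesis psi1 : nrm2 psi = 1.
Variable z : R[i].
Hypothesis Upsi : U *m psi = z *: psi.

Definition rho (j : 'I_(p ^ k)) : R := cmod2 (psi j ord0).

Lemma eigenvalue_unimodular : cmod2 z = 1.
Proof.
have : nrm2 (U *m psi) = 1 by rewrite U_isometry.
rewrite Upsi /nrm2; under eq_bigr do rewrite mxE cmod2M.
by rewrite -mulr_sumr [X in _ * X]psi1 mulr1.
Qed.

Lemma qpow_psi m j : cmod2 ((qpow m *m psi) j ord0) = rho j.
Proof.
elim: m j => [|m IH] j; first by rewrite mul1mx.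
have -> : qpow m.+1 *m psi = z *: (qpow m *m psi).
  elim: {IH} m => [|m IH]; first by rewrite qpowS /qpow /= !mul1mx.
  by rewrite [LHS]qpowS {1}IH -scalemxAr -qpowS.
by rewrite mxE cmod2M eigenvalue_unimodular mul1r.
Qed.

(** The hypothesis says that U intertwines the projections, U 1_B = 1_A U. Applied to [psi] this
    gives z 1_A psi, of the same norm as 1_B psi. *)
Lemma mass_invariant (A B : pred 'I_(p ^ k)) :
  (forall i j, U i j != 0 -> A i = B j) -> mass rho A = mass rho B.
Proof.
move=> AB; pose v : 'cV[R[i]]_(p ^ k) := \col_j (if B j then psi j ord0 else 0).
have vE : nrm2 v = mass rho B.
  rewrite /nrm2 /mass [RHS]big_mkcond; apply: eq_bigr => j _; rewrite mxE.
  by case: ifP => // _; exact: cmod2_0.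
rewrite -vE -U_isometry /nrm2 /mass big_mkcond; apply: eq_bigr => i _.
have -> : (U *m v) i ord0 = if A i then (U *m psi) i ord0 else 0.
  rewrite !mxE; case: ifPn => Ai.
    apply: eq_bigr => j _; rewrite mxE.
    have [->|Uij] := eqVneq (U i j) 0; first by rewrite !mul0r.
    by rewrite -(AB i j Uij) Ai.
  rewrite big1// => j _; rewrite mxE.
  have [->|Uij] := eqVneq (U i j) 0; first by rewrite !mul0r.
  by rewrite -(AB i j Uij) (negbTE Ai) mulr0.
case: ifP => _; last by rewrite cmod2_0.
by rewrite Upsi mxE cmod2M eigenvalue_unimodular mul1r.
Qed.

Lemma mass_cyl_shift w m s : ((m + s) * nmax <= k)%N ->
  mass rho (fun j => in_cyl w m (iter s T (grid j))) =
  mass rho (fun j => in_cyl w m (grid j)).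
Proof.
elim: s => // s IH mk; rewrite -IH; last first.
  by rewrite (leq_trans _ mk)// leq_mul2r addnS leqnSn orbT.
apply/esym/mass_invariant => i j Uij; apply: eq_forallb => t.
rewrite -!iterD (quantization_itinerary (K := m + s.+1) Uij)// ?addnS//.
by rewrite ltnS ltn_add2r.
Qed.

Let rho_ge0 j : 0 <= rho j.
Proof. exact: cmod2_ge0. Qed.

(* The points of the cylinder w that escape to the constant itinerary c sit
   next to an endpoint of that cylinder. They inject, disjointly over r, into
   the differences of the stationary masses of c^(mr) and c^(m(r+1)). *)
Lemma mass_cyl_endpoint w m c r : ((m + m * r) * nmax <= k)%N ->
  (exists2 t, (t < m)%N & w t != c) ->
  mass rho (fun j => in_cyl w m (grid j) &&
                     in_cyl (fun=> c) (m * r) (iter m T (grid j))) * r%:R <= 1.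
Proof.
move=> rk [t0 t0m wt0].
pose D s := mass rho (fun j => in_cyl (fun=> c) (m * s) (grid j)).
set X := mass rho _.
have D0 s : 0 <= D s by exact: mass_ge0.
(* By stationarity, D_s is the mass of the points whose m-th iterate starts with c^(ms). Those
   counted by [X] start with w, those counted by D_(s+1) with c^m, and w differs from c^m. *)
have step s : (s < r)%N -> X + D s.+1 <= D s.
  move=> sr; rewrite /D -(@mass_cyl_shift (fun=> c) (m * s) m); last first.
    by rewrite (leq_trans _ rk)// leq_mul2r addnC leq_add2l leq_mul2l (ltnW sr) !orbT.
  have cE j : in_cyl (fun=> c) (m * s.+1) (grid j) =
      in_cyl (fun=> c) m (grid j) && in_cyl (fun=> c) (m * s) (iter m T (grid j)).
    rewrite -in_cyl_cat mulnS; apply: eq_in_cyl => t _; by case: ifP.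
  apply: mass_disjoint => // j; rewrite ?cE.
  - move=> /andP[_ /in_cylP cj]; apply/in_cylP => t ts; apply: cj.
    by rewrite (leq_trans ts)// leq_mul2l (ltnW sr) orbT.
  - by move=> /andP[].
  - apply/negP => /andP[/andP[/in_cylP wj _] /andP[/in_cylP cj _]].
    by move: wt0; rewrite -(wj _ t0m) -(cj _ t0m) eqxx.
suff H s : (s <= r)%N -> X * s%:R + D s <= 1.
  by apply: le_trans (H r (leqnn r)); rewrite lerDl.
elim: s => [|s IH] sr.
  rewrite mulr0 add0r -psi1 /D /mass big_mkcond; apply: ler_sum => j _.
  by case: ifP => // _; exact: rho_ge0.
apply: le_trans (IH (ltnW sr)); rewrite -natr1 mulrDr mulr1 -addrA lerD2l.
exact: step.
Qed.

(** * Entropy of itineraries at a fixed level k *)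

Local Notation itinerary := (@itinerary R p l n).
Local Notation kentropy m := (entropy rho (fun j => itinerary m (grid j))).

Definition mean_log_slope : R := \sum_j rho j * ln (L (branch (grid j))).

Lemma mean_log_slope_shift t : (t.+1 * nmax <= k)%N ->
  \sum_j rho j * ln (L (branch (iter t T (grid j)))) = mean_log_slope.
Proof.
move=> tk; rewrite /mean_log_slope.
rewrite (expectation_partition _ (fun j => branch (iter t T (grid j))) (fun b => ln (L b))).
rewrite (expectation_partition _ (fun j => branch (grid j)) (fun b => ln (L b))).
apply: eq_bigr => b _; congr (_ * _).
have bE x : (branch x == b) = in_cyl (fun=> b) 1 x.
  by apply/eqP/in_cylP => [xb [|//]|/(_ 0%N isT)].
under [LHS]eq_bigl do rewrite bE.
under [RHS]eq_bigl do rewrite bE.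
exact: (@mass_cyl_shift (fun=> b) 1 t).
Qed.

(** A word of length m + m' is a pair of words, and the law of the second one is shifted back by
    stationarity. *)
Lemma kentropy_cat m m' : ((m + m') * nmax <= k)%N ->
  kentropy (m + m') <= kentropy m + kentropy m'.
Proof.
move=> mk.
have -> : kentropy m' = entropy rho (fun j => itinerary m' (iter m T (grid j))).
  apply: eq_entropy_law => w; under [LHS]eq_bigl do rewrite itineraryE.
  under [RHS]eq_bigl do rewrite itineraryE.
  by apply/esym/mass_cyl_shift; rewrite addnC.
apply: le_trans (entropy_pair _ _ _ _); last 2 first.
- by [].
- exact: psi1.
rewrite (eq_entropy _ (g := fun j => (itinerary m (grid j), itinerary m' (iter m T (grid j)))))//.
move=> i j; rewrite xpair_eqE !itineraryE.
rewrite -in_cyl_cat; apply: eq_in_cyl => t tm.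
rewrite [LHS]word_of_itinerary//; case: ltnP => tm'; first by rewrite word_of_itinerary.
by rewrite word_of_itinerary ?ltn_subLR// -iterD subnK.
Qed.

Lemma kentropy_mul q m : (q * m * nmax <= k)%N ->
  kentropy (q * m) <= q%:R * kentropy m.
Proof.
elim: q => [|q IH] qk.
  (* For q = 0 all itineraries are empty, so the only level set has full mass and log 1 = 0. *)
  rewrite mul0r mul0n oppr_le0; apply: sumr_ge0 => j _; rewrite mulr_ge0//.
  rewrite (_ : mass _ _ = 1) ?ln1// -psi1; apply: eq_bigl => i.
  by apply/eqP/ffunP => -[].
rewrite mulSn -natr1 mulrDl mul1r addrC.
apply: le_trans (kentropy_cat _) _; first by rewrite -mulSn.
by rewrite lerD2l IH// (leq_trans _ qk)// mulSn leq_mul2r leq_addl orbT.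
Qed.

(** The uncertainty principle for V = U^m and the partition into cylinders; stationarity turns the
    mean of log L_w into m times the mean of one letter. *)
Lemma kentropy_ge m : (m * nmax <= k)%N ->
  m%:R * mean_log_slope - ln N%:R / 2 <= kentropy m.
Proof.
move=> mk.
have := @entropic_uncertainty R N _ (qpow m) psi (fun j => itinerary m (grid j))
  (fun w => slope (word_of w) m) (qpow_isometry m) psi1 (qpow_psi m)
  (fun w => cyl_slope_gt0 R n p_ge2 _ m).
have Nn0 : (0 < N)%N by rewrite -(ltr0n R).
have Vdisp (w : {ffun 'I_m -> 'I_l.+1}) (v : 'cV[R[i]]_N) :
    (forall j, itinerary m (grid j) != w -> v j ord0 = 0) ->
    forall i, cmod2 ((qpow m *m v) i ord0) <= nrm2 v / slope (word_of w) m.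
  by move=> vw i; apply: qpow_dispersive => // j wj; apply: vw; rewrite itineraryE.
have fcard (w : {ffun 'I_m -> 'I_l.+1}) :
    (\sum_(j | itinerary m (grid j) == w) 1) * slope (word_of w) m <= N%:R.
  by under eq_bigl do rewrite itineraryE; exact: card_cyl_le.
move=> /(_ Nn0 Vdisp fcard); rewrite -/rho.
have -> : \sum_j rho j * ln (slope (word_of (itinerary m (grid j))) m) =
    m%:R * mean_log_slope.
  rewrite -[m in m%:R]card_ord -sumr_const mulr_suml.
  under [RHS]eq_bigr => t _.
    rewrite mul1r -(@mean_log_slope_shift t); last first.
      by rewrite (leq_trans _ mk)// leq_mul2r ltn_ord orbT.
    over.
  rewrite exchange_big; apply: eq_bigr => j _ /=; rewrite -mulr_sumr; congr (_ * _).
  rewrite (ln_cyl_slope R n p_ge2); apply: eq_bigr => t _.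
  by rewrite word_of_itinerary.
lra.
Qed.

End QuantizedMap.

(** * Test functions for cylinders *)

Section Trapezoid.
Variables (R : realType) (p l : nat) (n : 'I_l.+1 -> nat).
Hypothesis p_ge2 : (2 <= p)%N.
Hypothesis sumV : \sum_(j < l.+1) ((p ^ n j)%:R : R)^-1 = 1.

Local Notation T := (@Tp R p l.+1 n).
Local Notation in_cyl := (@in_cyl R p l n).
Local Notation slope := (cyl_slope R p n).
Local Notation left := (cyl_left R p n).
Local Notation is_const c w m := [forall t : 'I_m, w t == c].

Lemma is_constP (c : 'I_l.+1) (w : nat -> 'I_l.+1) m :
  is_const c w m -> forall t, (t < m)%N -> w t = c.
Proof. by move=> /forallP H t tm; apply/eqP; apply: (H (Ordinal tm)). Qed.

(* There is no slanted side at the endpoints 0 and 1, where the limit measure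
   may have atoms. *)
Definition trapezoid (w : nat -> 'I_l.+1) (m M : nat) (x : R) : R :=
  let y := slope w m * (x - left w m) in
  Num.max 0 (Num.min 1 (Num.min
    (if is_const ord0 w m then 1 else y * slope (fun=> ord0) M)
    (if is_const ord_max w m then 1 else (1 - y) * slope (fun=> ord_max) M))).

Lemma continuous_trapezoid w m M : continuous (trapezoid w m M).
Proof.
pose y (x : R) := slope w m * (x - left w m).
have cy : continuous y.
  move=> x; apply: cvgM; first exact: cvg_cst.
  by apply: cvgB; [exact: cvg_id|exact: cvg_cst].
pose f (x : R) := if is_const ord0 w m then 1 else y x * slope (fun=> ord0) M.
pose g (x : R) := if is_const ord_max w m then 1
  else (1 - y x) * slope (fun=> ord_max) M.
have cf : continuous f.
  rewrite /f; case: [forall t, _] => x; first exact: cvg_cst.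
  by apply: cvgM; [exact: cy|exact: cvg_cst].
have cg : continuous g.
  rewrite /g; case: [forall t, _] => x; first exact: cvg_cst.
  apply: cvgM; last exact: cvg_cst.
  by apply: cvgB; [exact: cvg_cst|exact: cy].
have -> : trapezoid w m M = (cst 0 : R -> R^o) \max (cst 1 \min (f \min g)) by [].
move=> x; apply: continuous_max; first exact: cvg_cst.
apply: continuous_min; first exact: cvg_cst.
by apply: continuous_min; [exact: cf|exact: cg].
Qed.

Lemma trapezoid_ge0 w m M x : 0 <= trapezoid w m M x.
Proof. by rewrite /trapezoid le_max lexx. Qed.

Lemma trapezoid_le1 w m M x : trapezoid w m M x <= 1.
Proof. by rewrite /trapezoid ge_max ler01 ge_min lexx. Qed.

(** Positivity of the sides forces 0 < y < 1 at a slanted side; where a side is omitted, the bound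
    on y comes from x lying in [0,1]. *)
Lemma trapezoid_le w m M x : 0 <= x <= 1 ->
  trapezoid w m M x <= (in_cyl w m x)%:R.
Proof.
move=> /andP[x0 x1]; have [_|wx] := boolP (in_cyl w m x).
  by rewrite mulr1n trapezoid_le1.
rewrite /trapezoid /=; set y := slope w m * _.
have s0 := cyl_slope_gt0 R n p_ge2.
rewrite ge_max lexx /= leNgt !lt_min ltr01 /=; apply: contra wx => /andP[].
case: ifPn => [c0 _|_]; [have y0 : 0 <= y|rewrite pmulr_lgt0// => /ltW y0].
- rewrite /y (eq_cyl_left R p n (is_constP c0)) cyl_left_min// subr0 mulr_ge0//.
  exact: ltW.
- case: ifPn => [c1 _|_]; last first.
    rewrite pmulr_lgt0// subr_gt0 => y1.
    by apply: (cyl_affine_in p_ge2 sumV _).1; rewrite -/y y0.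
  have wE := is_constP c1.
  (* The point 1 lies in the last cylinder but outside the half-open interval of [cyl_affine_in]. *)
  move: x1; rewrite le_eqVlt => /predU1P[->|x1].
    by rewrite (eq_in_cyl _ _ _ wE) in_cyl_max.
  apply: (cyl_affine_in p_ge2 sumV _).1; rewrite -/y y0 /=.
  rewrite /y (eq_cyl_left R p n wE) (eq_cyl_slope R p n wE) cyl_left_max//.
  set s := slope _ _; have ss : 0 < s by exact: s0.
  rewrite opprB addrCA mulrDr divff ?lt0r_neq0// gtrDl pmulr_rlt0// subr_lt0//.
- case: ifPn => [c1 _|_]; last first.
    rewrite pmulr_lgt0// subr_gt0 => y1.
    by apply: (cyl_affine_in p_ge2 sumV _).1; rewrite -/y y0.
  have wE := is_constP c1.
  move: x1; rewrite le_eqVlt => /predU1P[->|x1].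
    by rewrite (eq_in_cyl _ _ _ wE) in_cyl_max.
  apply: (cyl_affine_in p_ge2 sumV _).1; rewrite -/y y0 /=.
  rewrite /y (eq_cyl_left R p n wE) (eq_cyl_slope R p n wE) cyl_left_max//.
  set s := slope _ _; have ss : 0 < s by exact: s0.
  rewrite opprB addrCA mulrDr divff ?lt0r_neq0// gtrDl pmulr_rlt0// subr_lt0//.
Qed.

(** The steepness of the sides is chosen so that where a slanted side is below 1, T^m x lies in the
    cylinder of the constant word of length M at that end. *)
Lemma trapezoid_eq1 w m M x : 0 <= x < 1 -> in_cyl w m x ->
  (~~ is_const ord0 w m -> ~~ in_cyl (fun=> ord0) M (iter m T x)) ->
  (~~ is_const ord_max w m -> ~~ in_cyl (fun=> ord_max) M (iter m T x)) ->
  trapezoid w m M x = 1.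
Proof.
move=> x01 wx H0 H1.
have s0 := cyl_slope_gt0 R n p_ge2.
have /andP[y0 y1] : 0 <= iter m T x < 1 by exact: iter_Tp_co.
have [_ yE] : 0 <= iter m T x <= 1 /\ iter m T x = slope w m * (x - left w m).
  by apply: iter_Tp_affine => //; case/andP: x01 => -> /ltW.
rewrite /trapezoid -yE /=; set y := iter m T x in y0 y1 H0 H1 *.
rewrite min_l ?max_r ?ler01// le_min; apply/andP; split.
  case: ifPn => // /H0; rewrite leNgt; apply: contra => yM.
  apply: (cyl_affine_in p_ge2 sumV _).1; rewrite cyl_left_min// subr0.
  by rewrite mulr_ge0 ?(ltW (s0 _ _))//= mulrC.
case: ifPn => // /H1; rewrite leNgt; apply: contra => yM.
apply: (cyl_affine_in p_ge2 sumV _).1; rewrite cyl_left_max//.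
set s := slope _ _ in yM *; have ss : 0 < s by exact: s0.
rewrite opprB addrCA mulrDr divff ?lt0r_neq0//.
by apply/andP; split; nra.
Qed.

End Trapezoid.

(** * Cylinder masses against integrals of test functions *)

Section CellIntegrals.
Variables (R : realType) (p l : nat) (n : 'I_l.+1 -> nat).
Hypothesis p_ge2 : (2 <= p)%N.
Hypothesis sumV : \sum_(j < l.+1) ((p ^ n j)%:R : R)^-1 = 1.
Variables (k : nat) (U : 'M[R[i]]_(p ^ k)).
Hypothesis quantU : is_quantization (Tp p n) U.
Variable psi : 'cV[R[i]]_(p ^ k).
Hypothesis psi1 : nrm2 psi = 1.
Variable z : R[i].
Hypothesis Upsi : U *m psi = z *: psi.

Local Notation T := (@Tp R p l.+1 n).
Local Notation in_cyl := (@in_cyl R p l n).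
Local Notation nmax := (nmax n).
Local Notation grid := (@grid R p k).
Local Notation is_const c w m := [forall t : 'I_m, w t == c].

Lemma continuous_integrable_itv (f : R -> R) (a b : R) : continuous f ->
  lebesgue_measure.-integrable `[a, b]%classic (EFin \o f).
Proof.
move=> cf; apply: continuous_compact_integrable; first exact: segment_compact.
exact: continuous_subspaceT.
Qed.

(** Cells of C_w away from its inner endpoints see the value 1 of the test function. The others form
    one family per endpoint, each of mass at most 1 / r by [mass_cyl_endpoint], hence the loss 2 /
    r. *)
Lemma semiclassical_int_trapezoid w m r : (0 < r)%N -> ((m + m * r) * nmax <= k)%N ->
  mass (rho psi) (fun j => in_cyl w m (grid j)) - 2 / r%:R <=
  semiclassical_int psi (trapezoid p n w m (m * r)).
Proof.
move=> r0 rk; set f := trapezoid _ _ _ _ _.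
have rr0 : 0 < r%:R :> R by rewrite ltr0n.
have N0 : 0 < (p ^ k)%:R :> R by rewrite ltr0n expn_gt0 (ltnW p_ge2).
pose bad c j := ~~ is_const c w m && (in_cyl w m (grid j) &&
  in_cyl (fun=> c) (m * r) (iter m T (grid j))).
pose good j := [&& in_cyl w m (grid j), ~~ bad ord0 j & ~~ bad ord_max j].
have rho0 j : 0 <= rho psi j by exact: cmod2_ge0.
have bad_le c : mass (rho psi) (bad c) <= r%:R^-1.
  have [wc|] := boolP (is_const c w m).
    by rewrite /mass big_pred0 ?invr_ge0 ?(ltW rr0)// => j; rewrite /bad wc.
  move=> wc; rewrite -div1r ler_pdivlMr//.
  have [t tm wt] : exists2 t, (t < m)%N & w t != c.
    by move/forallPn : wc => [t wt]; exists t.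
  apply: le_trans (mass_cyl_endpoint p_ge2 sumV quantU psi1 Upsi rk _); last first.
    by exists t; [exact: tm|exact: wt].
  rewrite ler_pM2r//; apply: mass_sub => // j; by case/andP.
have cell_ge0 j : 0 <= Rintegral lebesgue_measure (Ecell j) f.
  by apply: Rintegral_ge0 => x _; exact: trapezoid_ge0.
have cell_good (j : 'I_(p ^ k)) : good j ->
    (p ^ k)%:R * Rintegral lebesgue_measure (Ecell j) f = 1.
  move=> /and3P[wj /negP bad0 /negP bad1].
  have cf := @continuous_trapezoid R p l n w m (m * r).
  (* The right endpoint is dropped because the itinerary of the cell may change there. *)
  rewrite /Ecell -Rintegral_itv_bndo_bndc; last first.
    apply: integrableS (continuous_integrable_itv
      (j%:R / (p ^ k)%:R) (j.+1%:R / (p ^ k)%:R) cf) => //.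
    by move=> x; rewrite /= !in_itv /= => /andP[jx /ltW xj]; apply/andP.
  rewrite (@eq_Rintegral _ _ _ _ _ (cst 1)); last first.
    move=> x; rewrite inE /= in_itv /= => jx.
    have jx' : 0 <= (p ^ k)%:R * x - j%:R < 1.
      move: jx; rewrite ler_pdivrMr// ltr_pdivlMr// ![x * _]mulrC.
      by rewrite subr_ge0 ltrBlDl natr1.
    have x01 : 0 <= x < 1 by exact: half_open_co jx'.
    have xj := padic_eq_itinerary p_ge2 sumV rk x01 (grid_co R p_ge2 j)
      (padic_eq_grid p_ge2 jx').
    have cx c : in_cyl (fun=> c) (m * r) (iter m T x) ->
        in_cyl (fun=> c) (m * r) (iter m T (grid j)).
      move=> /in_cylP H; apply/in_cylP => t tm; rewrite -(H t tm) -!iterD xj//.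
      by rewrite addnC ltn_add2l.
    apply: trapezoid_eq1 => //.
    - move/in_cylP: wj => wj; apply/in_cylP => t tm; rewrite -(wj t tm).
      by apply: xj; rewrite (leq_trans tm)// leq_addr.
    - move=> c0; apply/negP => /cx c1; apply: bad0; by rewrite /bad c0 wj.
    - move=> c0; apply/negP => /cx c1; apply: bad1; by rewrite /bad c0 wj.
  rewrite Rintegral_cst; last exact: measurable_itv.
  rewrite mul1r [X in fine X]lebesgue_measure_itv /= lte_fin.
  rewrite ltr_pM2r ?invr_gt0// ltr_nat ltnSn /=.
  by rewrite -mulrBl -natr1 [_ + 1]addrC addrK mul1r divff// lt0r_neq0.
have le_good : mass (rho psi) good <= semiclassical_int psi f.
  rewrite /mass big_mkcond; apply: ler_sum => j _.
  case: ifPn => [gj|_]; first by rewrite (cell_good j gj) mulr1.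
  by rewrite !mulr_ge0 ?cmod2_ge0// ltW.
suff : mass (rho psi) (fun j => in_cyl w m (grid j)) <=
    mass (rho psi) good + mass (rho psi) (bad ord0) + mass (rho psi) (bad ord_max).
  have := bad_le ord0; have := bad_le ord_max; lra.
rewrite /mass big_mkcond [X in _ <= X + _ + _]big_mkcond.
rewrite [X in _ <= _ + X + _]big_mkcond [X in _ <= _ + X]big_mkcond.
rewrite -!big_split; apply: ler_sum => j _ /=.
rewrite /good; have := rho0 j.
by case: (in_cyl w m (grid j)); case: (bad _ j); case: (bad _ j) => /=; lra.
Qed.

End CellIntegrals.

(** * Continuity of the entropy function and Fekete's lemma *)

Section EntFun.
Variable R : realType.

Lemma ent_funE (x : R) : ent_fun x = - (x * ln x).
Proof. by rewrite /ent_fun; case: eqP => // ->; rewrite mul0r oppr0. Qed.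

Lemma ent_fun_ge0 (x : R) : 0 <= x <= 1 -> 0 <= ent_fun x.
Proof. by move=> /andP[x0 x1]; rewrite ent_funE -mulrN mulr_ge0// oppr_ge0 ln_le0. Qed.

(** Gives continuity at 0 from ln u <= u alone: u = x bounds the logarithm above, u = 1 / sqrt x
    bounds it below. *)
Lemma ent_fun_norm_le (x : R) : 0 <= x -> `|ent_fun x| <= 2 * Num.sqrt x + x ^+ 2.
Proof.
rewrite ent_funE normrN le_eqVlt => /predU1P[<-|x0].
  by rewrite mul0r normr0 sqrtr0 mulr0 expr0n addr0.
have s0 : 0 < Num.sqrt x by rewrite sqrtr_gt0.
have xE : x = Num.sqrt x ^+ 2 by rewrite sqr_sqrtr// ltW.
have lb : - 2 / Num.sqrt x <= ln x.
  rewrite [X in ln X]xE lnXn// -mulr_natl.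
  have := ln_sublinear (x := (Num.sqrt x)^-1); rewrite invr_gt0 lnV ?posrE// => /(_ s0).
  lra.
have ub : ln x <= x by apply/ltW/ln_sublinear.
have e : x * (2 / Num.sqrt x) = 2 * Num.sqrt x.
  by rewrite {1}xE expr2; field; rewrite lt0r_neq0.
rewrite ler_norml; apply/andP; split.
  rewrite -e opprD -mulrN -mulNr lerBlDr; apply: le_trans (_ : x * ln x <= _).
    by rewrite ler_pM2l.
  by rewrite lerDl sqr_ge0.
rewrite expr2; apply: le_trans (_ : x * x <= _); first by rewrite ler_pM2l.
by rewrite lerDr mulr_ge0// ltW.
Qed.

Lemma cvg_ent_fun (u : R^nat) (x : R) : (forall k, 0 <= u k) -> 0 <= x ->
  u @ \oo --> x -> (fun k => ent_fun (u k)) @ \oo --> ent_fun x.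
Proof.
move=> u0 x0 ux; move: x0; rewrite le_eqVlt => /predU1P[x0|x0]; last first.
  rewrite ent_funE; under eq_fun do rewrite ent_funE.
  apply: cvgN; apply: cvgM => //.
  by apply: continuous_cvg => //; exact: continuous_ln.
rewrite -x0 /ent_fun eqxx; apply: norm_cvg0.
apply: (@squeeze_cvgr _ _ _ _ (fun=> 0) (fun k => 2 * Num.sqrt (u k) + u k ^+ 2)).
- by apply: nearW => k; rewrite normr_ge0 ent_fun_norm_le.
- exact: cvg_cst.
- have -> : 0 = 2 * Num.sqrt 0 + 0 ^+ 2 :> R by rewrite sqrtr0 mulr0 expr0n addr0.
  rewrite x0; apply: cvgD.
    apply: cvgM; first exact: cvg_cst.
    by apply: continuous_cvg => //; exact: sqrt_continuous.
  by rewrite expr2; under eq_fun do rewrite expr2; apply: cvgM.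
Qed.

End EntFun.

(* Fekete's lemma, for nonnegative sequences. *)
Lemma subadditive_limn_ge (R : realType) (h : nat -> R) (B : R) :
  (forall m, 0 <= h m) -> (forall m m', h (m + m')%N <= h m + h m') ->
  (forall m, (0 < m)%N -> m%:R * B <= h m) ->
  B <= limn ((fun k => h k.+1 / k.+1%:R) : R^nat).
Proof.
move=> h0 hD hB; pose s := inf [set h k.+1 / k.+1%:R | k in [set: nat]].
have hinf : has_inf [set h k.+1 / k.+1%:R | k in [set: nat]].
  split; first by exists (h 1%N / 1); exists 0%N.
  by exists 0 => _ [k _ <-]; rewrite divr_ge0.
have hmul q m r : h (q * m + r)%N <= q%:R * h m + h r.
  elim: q => [|q IH]; first by rewrite mul0r add0r.
  rewrite mulSn -addnA; apply: le_trans (hD _ _) _.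
  by rewrite -natr1 mulrDl mul1r; lra.
have cvgs : ((fun k => h k.+1 / k.+1%:R) : R^nat) @ \oo --> s.
  apply/cvgrPdist_le => e e0.
  (* [m.+1] nearly attains the infimum, and [C] dominates [h] at every remainder modulo [m.+1]. *)
  have [_ [m _ <-] hm] := inf_adherent (divr_gt0 e0 (ltr0Sn R 1)) hinf.
  pose C := \sum_(r < m.+1) h r.
  have C0 : 0 <= C by apply: sumr_ge0.
  near=> k.
  have lek : s <= h k.+1 / k.+1%:R by apply: ge_inf; [exact: hinf.2|exists k].
  rewrite distrC ger0_norm ?subr_ge0// lerBlDl.
  have kC : C / k.+1%:R <= e / 2.
    rewrite ler_pdivrMr ?ltr0n// mulrC -ler_pdivrMr ?divr_gt0//.
    apply: le_trans (_ : k%:R <= _); last by rewrite ler_nat.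
    by near: k; exact: nbhs_infty_ger.
  suff : h k.+1 / k.+1%:R <= h m.+1 / m.+1%:R + C / k.+1%:R.
    move=> /le_trans; apply; apply: le_trans (lerD (ltW hm) kC) _.
    by rewrite -/s; lra.
  rewrite ler_pdivrMr ?ltr0n// mulrDl divfK ?pnatr_eq0//.
  rewrite [in leLHS](divn_eq k.+1 m.+1); apply: le_trans (hmul _ _ _) _.
  apply: lerD; last first.
    by rewrite /C (bigD1 (Ordinal (ltn_pmod k.+1 (ltn0Sn m))))//= lerDl sumr_ge0.
  rewrite [leRHS]mulrAC -mulrA [leRHS]mulrC ler_wpM2r//.
  by rewrite ler_pdivlMr ?ltr0n// -natrM ler_nat leq_trunc_div.
rewrite (cvg_lim _ cvgs)//; apply: lb_le_inf; first exact: hinf.1.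
by move=> _ [k _ <-]; rewrite ler_pdivlMr ?ltr0n// mulrC hB.
Unshelve. all: by end_near. Qed.

(** * Semiclassical measures *)

Section CylinderMeasure.
Variables (R : realType) (p l : nat) (n : 'I_l.+1 -> nat).
Local Notation T := (@Tp R p l.+1 n).
Local Notation branch := (@branch R p l n).
Local Notation in_cyl := (@in_cyl R p l n).

Hypothesis p_ge2 : (2 <= p)%N.

Lemma measurable_branch (b : 'I_l.+1) : measurable [set x : R | branch x = b].
Proof.
(* The first branch also receives, by default, all points outside the intervals. *)
have -> : [set x : R | branch x = b] = @Iint R p l.+1 n b `|`
    (if b == ord0 then ~` \bigcup_(j in [set: 'I_l.+1]) @Iint R p l.+1 n j else set0).
  apply/seteqP; split => x /=.
    have [[j Ij]|H xb] := pselect (exists j, @Iint R p l.+1 n j x).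
      by rewrite (branchE p_ge2 Ij) => <-; left.
    right; rewrite -xb branch_default ?eqxx; first by move=> [j _ Ij]; apply: H; exists j.
    by move=> j Ij; apply: H; exists j.
  move=> [Ib|]; first exact: branchE Ib.
  by case: ifP => // /eqP -> H; apply: branch_default => j Ij; apply: H; exists j.
apply: measurableU; first exact: measurable_Iint.
case: ifP => // _; apply: measurableC; apply: fin_bigcup_measurable => //.
by move=> j _; exact: measurable_Iint.
Qed.

Lemma measurable_in_cyl w m : measurable [set x : R | in_cyl w m x].
Proof.
elim: m => [|m IH].
  rewrite (_ : [set _ | _] = setT) //; apply/seteqP; split => // x _ /=.
  by apply/in_cylP.
rewrite (_ : [set _ | _] = [set x | in_cyl w m x] `&`
    (iter m T @^-1` [set x | branch x = w m])); last first.
  apply/seteqP; split => x /=; rewrite in_cyl_recr.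
    by move=> /andP[-> /eqP].
  by move=> [-> ->]; rewrite eqxx.
apply: measurableI => //; rewrite -[X in measurable X]setTI.
by apply: measurable_iter_Tp => //; exact: measurable_branch.
Qed.

Lemma sum_measure_fibers (mu : probability R R) (W : finType) (g : R -> W) :
  (forall w, measurable [set x | g x = w]) ->
  \sum_w fine (mu [set x | g x = w]) = 1.
Proof.
move=> mg.
have H (s : seq W) : uniq s -> measurable [set x | g x \in s] /\
    mu [set x | g x \in s] = (\sum_(w <- s) mu [set x | g x = w])%E.
  elim: s => [_|w s IH /= /andP[ws us]].
    by rewrite big_nil (_ : [set _ | _] = set0) ?measure0//; apply/seteqP; split.
  have [ms Es] := IH us.
  have -> : [set x | g x \in w :: s] = [set x | g x = w] `|` [set x | g x \in s].
    apply/seteqP; split => x /=; rewrite inE; first by move=> /orP[/eqP|]; [left|right].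
    by move=> [->|->]; rewrite ?eqxx ?orbT.
  split; first exact: measurableU.
  rewrite big_cons -Es measureU//; apply/seteqP; split => // x [/= gx].
  by rewrite gx (negbTE ws).
have [_] := H _ (enum_uniq W).
rewrite (_ : [set x | g x \in enum W] = setT); last first.
  by apply/seteqP; split => // x _ /=; rewrite mem_enum.
rewrite big_enum /= probability_setT.
rewrite (eq_bigr (fun w => (fine (mu [set x | g x = w]))%:E)); last first.
  by move=> w _; rewrite fineK// fin_num_measure.
by rewrite sumEFin => -[].
Qed.

End CylinderMeasure.

(** * Passage to the limit and the entropy bound *)

Section Limit.
Variables (R : realType) (p l : nat) (n : 'I_l.+1 -> nat).
Variables (U : forall k : nat, 'M[R[i]]_(p ^ k)) (psi : forall k : nat, 'cV[R[i]]_(p ^ k)).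
Variables (mu : probability R R) (phi : nat -> nat).
Hypothesis p_ge2 : (2 <= p)%N.
Hypothesis n_ge1 : forall j, (1 <= n j)%N.
Hypothesis sumV : \sum_(j < l.+1) ((p ^ n j)%:R : R)^-1 = 1.
Hypothesis quantU : forall k, is_quantization (Tp p n) (U k).
Hypothesis eigen : forall k, exists z : R[i], U k *m psi k = z *: psi k.
Hypothesis psi1 : forall k, nrm2 (psi k) = 1.
Hypothesis phi_homo : {homo phi : a b / (a < b)%N}.
Hypothesis weak_cvg : forall f : R -> R, continuous f ->
  (fun k => semiclassical_int (psi (phi k)) f) @ \oo
    --> Rintegral mu [set` `[0, 1]] f.

Local Notation T := (@Tp R p l.+1 n).
Local Notation L := (Lam R p n).
Local Notation branch := (@branch R p l n).
Local Notation in_cyl := (@in_cyl R p l n).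
Local Notation itinerary := (@itinerary R p l n).
Local Notation nmax := (nmax n).
Local Notation rhok k := (rho (psi (phi k))).
Local Notation gridk k := (@grid R p (phi k)).

Lemma phi_ge k : (k <= phi k)%N.
Proof. by elim: k => // k IH; exact: leq_ltn_trans (phi_homo (ltnSn k)). Qed.

Let rho_ge0 k j : 0 <= rhok k j.
Proof. exact: cmod2_ge0. Qed.

(** The test function lies below the indicator of C_w on [0,1], so its limiting integral is at most
    the measure of C_w; [r] makes the endpoint loss at most e / 2. *)
Lemma mass_cyl_limit_le w m (e : R) : 0 < e ->
  \forall k \near \oo, mass (rhok k) (fun j => in_cyl w m (gridk k j)) <=
    fine (mu [set x | in_cyl w m x]) + e.
Proof.
move=> e0; pose r := (Num.bound (4 / e)).+1.
have r0 : (0 < r)%N by [].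
have re : 2 / r%:R <= e / 2.
  rewrite ler_pdivrMr ?ltr0n// mulrC -ler_pdivrMr ?divr_gt0//.
  have -> : 2 / (e / 2) = 4 / e by field; rewrite lt0r_neq0.
  apply/ltW/(lt_le_trans (archi_boundP (divr_ge0 (ler0n R 4) (ltW e0)))).
  by rewrite ler_nat leqnSn.
pose f := @trapezoid R p l n w m (m * r).
have cf : continuous f by exact: continuous_trapezoid.
have C := @measurable_in_cyl R p l n p_ge2 w m.
have mI : measurable (`[0, 1]%classic : set R) by exact: measurable_itv.
have mCI : measurable ([set x | in_cyl w m x] `&` `[0, 1]%classic) by exact: measurableI.
have intf : Rintegral mu [set` `[0, 1]] f <= fine (mu [set x | in_cyl w m x]).
  apply: (@le_trans _ _ (Rintegral mu [set` `[0, 1]] \1_[set x | in_cyl w m x])).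
    apply: le_Rintegral => //.
    - apply: measurable_bounded_integrable => //.
      + by rewrite ltey_eq fin_num_measure.
      + exact: measurable_funTS (continuous_measurable_fun cf).
      + exists 1; split => // M M1 x _ /=.
        by rewrite ger0_norm ?trapezoid_ge0// (le_trans (trapezoid_le1 _ _ _ _ _ _))// ltW.
    - by apply: integrableS (integrable_indic mu C).
    - move=> x Ix; have x01 : 0 <= x <= 1 by move: Ix; rewrite /= in_itv.
      rewrite /indic.
      by apply: le_trans (trapezoid_le p_ge2 sumV w m _ x01) _; rewrite mem_setE.
  rewrite /Rintegral integral_indic//.
  apply: fine_le; rewrite ?fin_num_measure//.
  by apply: le_measure; rewrite ?inE//; exact: subIsetl.
have lt : Rintegral mu [set` `[0, 1]] f < fine (mu [set x | in_cyl w m x]) + e / 2.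
  by apply: (le_lt_trans intf); rewrite ltrDl divr_gt0.
have near_le := cvgr_le _ (weak_cvg cf) _ lt; near=> k.
have h1 : semiclassical_int (psi (phi k)) f <= fine (mu [set x | in_cyl w m x]) + e / 2.
  by near: k; exact: near_le.
have [z Uz] := eigen (phi k).
have h2 := @semiclassical_int_trapezoid R p l n p_ge2 sumV (phi k) (U (phi k))
  (quantU _) (psi (phi k)) (psi1 _) z Uz w m r r0.
have kk : ((m + m * r) * nmax <= phi k)%N.
  by apply: leq_trans (phi_ge k); near: k; exact: nbhs_infty_ge.
by have := h2 kk; rewrite -/f; lra.
Unshelve. all: by end_near. Qed.

(** Masses and limits both have total 1, so an excess of at most e' on each of the other fibers
    bounds the deficit on [w]. *)
Lemma cvg_mass (W : finType) (g : R -> W) :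
  (forall w, measurable [set x | g x = w]) ->
  (forall w e, 0 < e -> \forall k \near \oo,
     mass (rhok k) (fun j => g (gridk k j) == w) <= fine (mu [set x | g x = w]) + e) ->
  forall w, (fun k => mass (rhok k) (fun j => g (gridk k j) == w)) @ \oo -->
    fine (mu [set x | g x = w]).
Proof.
move=> mg upper w; pose P k v := mass (rhok k) (fun j => g (gridk k j) == v).
pose M v := fine (mu [set x | g x = v]).
apply/cvgrPdist_le => e e0; pose e' := e / #|W|.+1%:R.
have e'0 : 0 < e' by rewrite divr_gt0// ltr0n.
have e'e : #|W|.+1%:R * e' = e by rewrite mulrC divfK// pnatr_eq0.
have near_upper : \forall k \near \oo, forall v, P k v <= M v + e'.
  by apply: filter_forall => v; exact: upper.
near=> k.
have PM : forall v, P k v <= M v + e' by near: k; exact: near_upper.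
have sumP : \sum_v P k v = 1 by rewrite sum_mass; exact: psi1.
have sumM : \sum_v M v = 1 by exact: sum_measure_fibers.
have W_le : #|W|%:R * e' <= e.
  by rewrite -e'e ler_wpM2r ?ler_nat// ltW.
have e'_le : e' <= e.
  by rewrite -[leLHS]mul1r -e'e ler_wpM2r ?ler1n// ltW.
have sum_le : \sum_(v | v != w) P k v <= \sum_(v | v != w) M v + (e - e').
  apply: (@le_trans _ _ (\sum_(v | v != w) (M v + e'))); first exact: ler_sum.
  rewrite big_split lerD2l sumr_const -mulr_natl lerBrDr.
  rewrite -[X in _ + X]mul1r -mulrDl -e'e ler_wpM2r ?(ltW e'0)// natr1 ler_nat ltnS.
  exact: max_card.
move: sumP sumM; rewrite (bigD1 w)//= (bigD1 w (F := M))//= => sumP sumM.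
have := PM w; rewrite -/(P k w) -/(M w) ler_norml => PMw.
by apply/andP; split; lra.
Unshelve. all: by end_near. Qed.

Definition limit_mass m (w : {ffun 'I_m -> 'I_l.+1}) : R :=
  fine (mu [set x | itinerary m x = w]).

Lemma itinerary_setE m (w : {ffun 'I_m -> 'I_l.+1}) :
  [set x : R | itinerary m x = w] = [set x | in_cyl (word_of w) m x].
Proof.
apply/seteqP; split => x /=; first by move=> /eqP; rewrite itineraryE.
by rewrite -itineraryE => /eqP.
Qed.

Lemma cvg_mass_itinerary m (w : {ffun 'I_m -> 'I_l.+1}) :
  (fun k => mass (rhok k) (fun j => itinerary m (gridk k j) == w)) @ \oo -->
    limit_mass w.
Proof.
apply: cvg_mass => [v|v e e0]; rewrite itinerary_setE.
  exact: measurable_in_cyl.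
have := mass_cyl_limit_le (word_of v) m e0; apply: filterS => k.
by rewrite /mass; under [X in _ -> X <= _]eq_bigl do rewrite itineraryE.
Qed.

Lemma cvg_mass_branch (b : 'I_l.+1) :
  (fun k => mass (rhok k) (fun j => branch (gridk k j) == b)) @ \oo -->
    fine (mu [set x | branch x = b]).
Proof.
have bE (v : 'I_l.+1) (x : R) : (branch x == v) = in_cyl (fun=> v) 1 x.
  by apply/eqP/in_cylP => [xv [|//]|/(_ 0%N isT)].
apply: cvg_mass => [v|v e e0]; first exact: measurable_branch.
have -> : [set x : R | branch x = v] = [set x | in_cyl (fun=> v) 1 x].
  by apply/seteqP; split => x /=; rewrite -bE => /eqP.
have := mass_cyl_limit_le (fun=> v) 1 e0; apply: filterS => k.
by rewrite /mass; under [X in _ -> X <= _]eq_bigl do rewrite bE.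
Qed.

Lemma cvg_bigsum (I : finType) (u : I -> R^nat) (a : I -> R) :
  (forall i, u i @ \oo --> a i) ->
  (fun k => \sum_i u i k) @ \oo --> \sum_i a i.
Proof.
move=> ua; elim: (index_enum I) => [|i s IH].
  by rewrite big_nil; under eq_fun do rewrite big_nil; exact: cvg_cst.
by rewrite big_cons; under eq_fun do rewrite big_cons; apply: cvgD.
Qed.

Definition limit_entropy m : R := \sum_w ent_fun (@limit_mass m w).

Local Notation kentropy k m := (entropy (rhok k) (fun j => itinerary m (gridk k j))).

Lemma limit_mass_ge0 m w : 0 <= @limit_mass m w.
Proof. exact: fine_ge0. Qed.

Lemma cvg_kentropy m : (fun k => kentropy k m) @ \oo --> limit_entropy m.
Proof.
under eq_fun do rewrite entropyE; apply: cvg_bigsum => w.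
apply: cvg_ent_fun; [|exact: limit_mass_ge0|exact: cvg_mass_itinerary].
by move=> k; apply: mass_ge0; exact: rho_ge0.
Qed.

Definition limit_log_slope : R :=
  \sum_b fine (mu [set x | branch x = b]) * ln (L b).

Lemma cvg_mean_log_slope :
  (fun k => mean_log_slope n (psi (phi k))) @ \oo --> limit_log_slope.
Proof.
rewrite /mean_log_slope.
under eq_fun => k do rewrite (expectation_partition _
  (fun j => branch (gridk k j)) (fun b => ln (L b))).
apply: cvg_bigsum => b; apply: cvgM; last exact: cvg_cst.
exact: cvg_mass_branch.
Qed.

Lemma limit_entropy_ge0 m : 0 <= limit_entropy m.
Proof.
apply: sumr_ge0 => w _; apply: ent_fun_ge0; rewrite limit_mass_ge0 /=.
rewrite -[leRHS]/(fine 1%:E) fine_le ?fin_num_measure//.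
  by rewrite itinerary_setE; exact: measurable_in_cyl.
by apply: probability_le1; rewrite itinerary_setE; exact: measurable_in_cyl.
Qed.

Lemma limit_entropyD m m' :
  limit_entropy (m + m') <= limit_entropy m + limit_entropy m'.
Proof.
have cvgs : (fun k => kentropy k m + kentropy k m') @ \oo -->
    limit_entropy m + limit_entropy m' by apply: cvgD; exact: cvg_kentropy.
apply: (ler_cvg_to (@cvg_kentropy (m + m')) cvgs).
near=> k; have [z Uz] := eigen (phi k).
apply: (kentropy_cat p_ge2 sumV (quantU _) (psi1 _) Uz).
by apply: leq_trans (phi_ge k); near: k; exact: nbhs_infty_ge.
Unshelve. all: by end_near. Qed.

Lemma nmax_gt0 : (0 < nmax)%N.
Proof. exact: leq_trans (n_ge1 ord0) (n_le_nmax n ord0). Qed.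

(** With q the quotient of [phi k] by d = m nmax, words of length q m give q h >= q m S - (phi k /
    2) log p, and phi k < (q + 1) d. Dividing by q leaves the error (1 + 1/q) [c], where [c] is m
    times (nmax / 2) log p. *)
Lemma limit_entropy_ge m : (0 < m)%N ->
  m%:R * (limit_log_slope - nmax%:R * ln p%:R / 2) <= limit_entropy m.
Proof.
move=> m0; pose d := (m * nmax)%N; pose c : R := d%:R * ln p%:R / 2.
have d0 : (0 < d)%N by rewrite muln_gt0 m0 nmax_gt0.
have lnp0 : 0 <= ln p%:R :> R by rewrite ln_ge0// ler1n ltnW.
have c0 : 0 <= c by rewrite !mulr_ge0.
(* The two limits are separated: k tends to infinity for a fixed lower bound [Q] on q, after which 1
   / Q is made small. *)
suff H Q : (0 < Q)%N -> m%:R * limit_log_slope - (1 + Q%:R^-1) * c <= limit_entropy m.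
  apply/ler_addgt0Pr => e e0; pose Q := (Num.bound (c / e)).+1.
  have cQ : Q%:R^-1 * c <= e.
    rewrite mulrC ler_pdivrMr ?ltr0n// mulrC -ler_pdivrMr//.
    apply/ltW/(lt_le_trans (archi_boundP (divr_ge0 c0 (ltW e0)))).
    by rewrite ler_nat leqnSn.
  have := H Q isT; rewrite mulrDl mul1r.
  have -> : m%:R * (limit_log_slope - nmax%:R * ln p%:R / 2) =
      m%:R * limit_log_slope - c by rewrite /c /d natrM; ring.
  by move=> h; lra.
move=> Q0.
have cvgl : (fun k => m%:R * mean_log_slope n (psi (phi k)) - (1 + Q%:R^-1) * c)
    @ \oo --> m%:R * limit_log_slope - (1 + Q%:R^-1) * c.
  apply: cvgB; last exact: cvg_cst.
  by apply: cvgM; [exact: cvg_cst|exact: cvg_mean_log_slope].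
apply: (ler_cvg_to cvgl (@cvg_kentropy m)).
near=> k; have [z Uz] := eigen (phi k).
set q := (phi k %/ d)%N; set S := mean_log_slope _ _; set h := kentropy k m.
have Qq : (Q <= q)%N.
  rewrite leq_divRL//; apply: leq_trans (phi_ge k).
  by near: k; exact: nbhs_infty_ge.
have qk : (q * m * nmax <= phi k)%N by rewrite -mulnA leq_trunc_div.
have := kentropy_ge p_ge2 sumV (quantU _) (psi1 _) Uz qk.
move=> /le_trans /(_ (kentropy_mul p_ge2 sumV (quantU _) (psi1 _) Uz qk)).
rewrite -/S -/h natrX lnXn ?ltr0n 1?ltnW// -mulr_natl natrM => hk.
have kq : (phi k)%:R * ln p%:R / 2 <= (q%:R + 1) * c.
  rewrite /c natr1 !mulrA -natrM ler_wpM2r// ler_wpM2r// ler_nat ltnW//.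
  by rewrite ltn_ceil.
have q0 : 0 < q%:R :> R by rewrite ltr0n (leq_trans Q0).
have h1 : m%:R * S - h <= (1 + q%:R^-1) * c.
  rewrite -(ler_pM2l q0).
  have -> : q%:R * ((1 + q%:R^-1) * c) = (q%:R + 1) * c.
    by rewrite mulrA mulrDr mulr1 divff// lt0r_neq0.
  by move: hk kq; lra.
have : (1 + q%:R^-1) * c <= (1 + Q%:R^-1) * c.
  by rewrite ler_wpM2r// lerD2l lef_pV2 ?posrE ?ltr0n// ?ler_nat// (leq_trans Q0).
lra.
Unshelve. all: by end_near. Qed.

Definition branch_partition (b : 'I_l.+1) : set R := [set x | branch x = b].

Lemma join_entropy_limit m :
  join_entropy mu T branch_partition m = limit_entropy m.
Proof.
apply: eq_bigr => w _; congr (ent_fun (fine (mu _))).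
apply/seteqP; split => x /=.
  by move=> H; apply/ffunP => t; rewrite ffunE; exact: (H t I).
by move=> <- t _; rewrite /= /branch_partition /= ffunE.
Qed.

Lemma branch_partition_fin : is_fin_partition branch_partition.
Proof.
split=> [b|]; first exact: measurable_branch.
split; first by move=> b b' _ _ [x [/= <- <-]].
by apply/seteqP; split => // x _; exists (branch x).
Qed.

(** The partition into branches is the competitor in the supremum: its joins are the cylinders,
    whose entropies are [limit_entropy]. *)
Lemma ks_entropy_ge :
  ((limit_log_slope - nmax%:R * ln p%:R / 2)%:E <= ks_entropy mu T)%E.
Proof.
apply: le_trans (ereal_sup_ubound _); last first.
  exists (existT (fun m => 'I_m -> set R) l.+1 branch_partition); last by [].
  exact: branch_partition_fin.
rewrite lee_fin /part_ks_entropy /=.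
under eq_fun do rewrite join_entropy_limit.
apply: subadditive_limn_ge; [exact: limit_entropy_ge0|exact: limit_entropyD|].
exact: limit_entropy_ge.
Qed.

(** Each interval is contained in the corresponding cell of the branch partition, and log L_j >= 0;
    the first cell also contains the points outside [0,1]. *)
Lemma limit_log_slope_ge :
  \sum_j fine (mu (@Iint R p l.+1 n j)) * ln (L j) <= limit_log_slope.
Proof.
apply: ler_sum => j _; rewrite ler_wpM2r ?ln_ge0 ?Lam_ge1//.
apply: fine_le; rewrite ?fin_num_measure//; try exact: measurable_Iint.
  exact: measurable_branch.
apply: le_measure; rewrite ?inE; [exact: measurable_Iint|exact: measurable_branch|].
by move=> x Ij /=; exact: branchE Ij.
Qed.

Lemma ln_bigmax_Lam :
  ln (\big[Num.max/0]_(j < l.+1) L j) = nmax%:R * ln p%:R.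
Proof.
have -> : \big[Num.max/0]_(j < l.+1) L j = p%:R ^+ nmax.
  rewrite -natrX; apply/le_anti/andP; split.
    apply: bigmax_le => // j _.
    by rewrite ler_nat leq_pexp2l ?(ltnW p_ge2)// n_le_nmax.
  have [j nj] : {j | nmax = n j} by apply: bigop.eq_bigmax; rewrite card_ord.
  rewrite nj.
  exact: (le_bigmax _ (fun j => L j)).
by rewrite lnXn ?ltr0n 1?ltnW// mulr_natl.
Qed.

End Limit.

Theorem theorem7 (R : realType) (p l : nat) (n : 'I_l -> nat)
  (U : forall k : nat, 'M[R[i]]_(p ^ k))
  (psi : forall k : nat, 'cV[R[i]]_(p ^ k))
  (mu : probability R R) (phi : nat -> nat) :
  (2 <= p)%N ->
  (forall j, 1 <= n j)%N ->
  \sum_(j < l) ((p ^ n j)%:R : R)^-1 = 1 ->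
  (forall k, is_quantization (Tp p n) (U k)) ->
  (forall k, exists z : R[i], U k *m psi k = z *: psi k) ->
  (forall k, \sum_(i < p ^ k) cmod2 (psi k i ord0) = 1) ->
  {homo phi : a b / (a < b)%N} ->
  mu [set` `[0, 1]] = 1%E ->
  (forall f : R -> R, continuous f ->
     (fun k => semiclassical_int (psi (phi k)) f) @ \oo
       --> Rintegral mu [set` `[0, 1]] f) ->
  (ks_entropy mu (Tp p n) >=
     (\sum_(j < l) fine (mu (Iint p n j)) * ln (Lam R p n j)
      - ln (\big[Num.max/0]_(j < l) Lam R p n j) / 2)%:E)%E.
Proof.
case: l n => [n|l n] p2 n1 sumV quantU eigen psi1 phi_homo _ weak.
  (* Without branches the sum of the lengths would be 0 instead of 1. *)
  by move: sumV; rewrite big_ord0 => /esym/eqP; rewrite oner_eq0.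
apply: le_trans (ks_entropy_ge p2 n1 sumV quantU eigen psi1 phi_homo weak).
by rewrite lee_fin (ln_bigmax_Lam R n p2) lerD2r (limit_log_slope_ge n mu p2).
Qed.
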